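(* Let $N \in \mathbb{N}$, $x_0, x_1, \ldots, x_N, a \in \mathbb{R}$, $b \in (a,\infty)$, $f \in C([a,b],\mathbb{R})$ satisfy $a = x_0 < x_1 < \cdots < x_N = b$, and assume for all $i \in \{1,2,\ldots,N\}$ that $f|_{[x_{i-1},x_i]}$ is affine linear. Let $R_r \in C(\mathbb{R},\mathbb{R})$, $r \in \mathbb{N}\cup\{\infty\}$, satisfy for all $x\in\mathbb{R}$ that $\{R_r : r\in\mathbb{N}\} \subseteq C^1(\mathbb{R},\mathbb{R})$, $R_\infty(x) = \max\{x,0\}$, $\sup_{r\in\mathbb{N}}\sup_{y\in[-|x|,|x|]} |(R_r)'(y)| < \infty$, and $$\limsup_{r\to\infty}\bigl(|R_r(x) - R_\infty(x)| + |(R_r)'(x) - \mathbf{1}_{(0,\infty)}(x)|\bigr) = 0.$$ Let $p\colon[a,b]\to(0,\infty)$ be Lipschitz continuous. For all $r\in\mathbb{N}\cup\{\infty\}$, $H\in\mathbb{N}$ let $L_r^H\colon\mathbb{R}^{3H+1}\to\mathbb{R}$ satisfy for all $\theta = (\theta_1,\ldots,\theta_{3H+1})\in\mathbb{R}^{3H+1}$ that $$L_r^H(\theta) = \int_a^b \Bigl(f(x) - \theta_{3H+1} - \sum_{j=1}^H \theta_{2H+j}\, R_r(\theta_j x + \theta_{H+j})\Bigr)^2 p(x)\,\mathrm{d}x .$$ For all $H\in\mathbb{N}$ let $G^H\colon\mathbb{R}^{3H+1}\to\mathbb{R}^{3H+1}$ satisfy for all $\theta\in\{\vartheta\in\mathbb{R}^{3H+1}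 : ((\nabla L_r^H)(\vartheta))_{r\in\mathbb{N}} \text{ is convergent}\}$ that $G^H(\theta) = \lim_{r\to\infty}(\nabla L_r^H)(\theta)$. Let $(\Omega,\mathcal{F},\mathbb{P})$ be a probability space, let $\Theta_n^{H,k,\gamma}\colon\Omega\to\mathbb{R}^{3H+1}$ and $\mathbf{k}_n^{H,k,\gamma}\colon\Omega\to\mathbb{N}$, $H,k\in\mathbb{N}$, $\gamma\in\mathbb{R}$, $n\in\mathbb{N}_0$, be random variables, assume for all $H\in\mathbb{N}$, $\gamma\in\mathbb{R}$ that $\Theta_0^{H,k,\gamma}$, $k\in\mathbb{N}$, are independent standard normal random vectors, and assume for all $H,k\in\mathbb{N}$, $\gamma\in\mathbb{R}$, $n\in\mathbb{N}_0$, $\omega\in\Omega$ that $$\Theta_{n+1}^{H,k,\gamma}(\omega) = \Theta_n^{H,k,\gamma}(\omega) - \gamma\, G^H(\Theta_n^{H,k,\gamma}(\omega)) \quad\text{and}\quad \mathbf{k}_n^{H,k,\gamma}(\omega) \in \operatorname*{arg\,min}_{\ell\in\{1,2,\ldots,k\}} L_\infty^H(\Theta_n^{H,\ell,\gamma}(\omega)).$$ Then there exists $g\in(0,\infty)$ such that for all $\gamma\in(0,g]$ it holds that $$\liminf_{H\to\infty}\,\liminf_{K\to\infty}\,\mathbb{P}\Bigl(\limsup_{n\to\infty} L_\infty^H\bigl(\Theta_n^{H,\mathbf{k}_n^{H,K,\gamma},\gamma}\bigr) = 0\Bigr) = 1 .$$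
   Context: $\mathbb{N}=\{1,2,3,\ldots\}$, $\mathbb{N}_0=\mathbb{N}\cup\{0\}$; $\mathbf{1}_A$ is the indicator function of $A$. The function $G^H$ is arbitrary at points where the sequence of gradients does not converge. *)

(* Defs.v *)
From HB Require Import structures.
From mathcomp Require Import all_boot all_order all_algebra.
From mathcomp Require Import finmap.
From mathcomp Require Import all_classical all_reals all_analysis.

Set Implicit Arguments.
Unset Strict Implicit.
Unset Printing Implicit Defensive.

Import Order.TTheory GRing.Theory Num.Theory.
Import numFieldNormedType.Exports.

Local Open Scope classical_set_scope.
Local Open Scope ring_scope.

Definition affine_on (R : realType) (I : set R) (f : R -> R) : Prop :=
  exists c d : R, forall t, I t -> f t = c * t + d.

Definition continuously_differentiable (R : realType) (g : R -> R) : Prop :=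
  (forall x, derivable g x 1) /\ continuous (derive1 g).

Definition argmin (R : realType) (T : Type) (A : set T) (F : T -> R) : set T :=
  [set x | A x /\ forall y, A y -> F x <= F y].

Definition gradient (R : realType) (n : nat) (F : 'rV[R]_n -> R)
    (theta : 'rV[R]_n) : 'rV[R]_n :=
  \row_i 'D_(delta_mx 0 i) F theta.

(* The parameter space R^(3H+1) is 'rV[R]_(3 * H).+1. Coordinates are numbered
   from 0, so for j : 'I_H the (inner) weight, bias and outer weight of the
   j-th neuron are the entries j, H + j and 2 * H + j, and the outer bias is
   the last entry. *)
Definition realization (R : realType) (act : R -> R) (H : nat)
    (theta : 'rV[R]_(3 * H).+1) (x : R) : R :=
  theta 0 ord_max
  + \sum_(j < H) theta 0 (inord (2 * H + j)) *
      act (theta 0 (inord j) * x + theta 0 (inord (H + j))).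

Definition risk (R : realType) (a b : R) (f p : R -> R) (act : R -> R)
    (H : nat) (theta : 'rV[R]_(3 * H).+1) : R :=
  \int[lebesgue_measure]_(x in `[a, b])
     ((f x - realization act theta x) ^+ 2 * p x).

Definition borel_rV (R : realType) (n : nat) :=
  g_sigma_algebraType (@open 'rV[R]_n).

Definition random_vector (d : measure_display) (T : measurableType d)
    (R : realType) (n : nat) (X : T -> 'rV[R]_n) : Prop :=
  measurable_fun [set: T] (X : T -> borel_rV R n).

Definition independent (d d' : measure_display) (T : measurableType d)
    (U : measurableType d') (R : realType) (P : probability T R)
    (I : choiceType) (D : set I) (X : I -> T -> U) : Prop :=
  forall (J : {fset I}) (A : I -> set U),
    [set` J] `<=` D ->
    (forall i, i \in J -> measurable (A i)) ->
    P (\bigcap_(i in [set` J]) X i @^-1` A i) =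
      (\prod_(i <- J) P (X i @^-1` A i))%E.

Definition standard_normal_vector (d : measure_display)
    (T : measurableType d) (R : realType) (P : probability T R) (n : nat)
    (X : T -> 'rV[R]_n) : Prop :=
  independent P [set: 'I_n] (fun i omega => X omega 0 i : measurableTypeR R) /\
  forall (i : 'I_n) (B : set (measurableTypeR R)), measurable B ->
    P [set omega | B (X omega 0 i)] = normal_prob 0 1 B.

(* Main.v *)
Require Import Defs.
From HB Require Import structures.
From mathcomp Require Import all_boot all_order all_algebra.
From mathcomp Require Import finmap.
From mathcomp Require Import all_classical all_reals all_analysis.
From mathcomp Require Import measurable_realfun.
From mathcomp Require Import ring lra zify.

(* N neurons suffice to represent f exactly: one that is affine on [a, b] and
   one for each interior breakpoint. In a wider network the remaining neurons may
   start where they vanish on [a, b]; their gradient is then zero, they never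
   move, and the dynamics are those of width N, so that the step size can be
   chosen independently of H. Near the exact network the error is, up to terms
   supported between the kinks of the network and the breakpoints of f, a
   combination of the partial derivatives of the network, with coefficients
   bounded by the L2 norm of the error. Hence the loss L satisfies a Lojasiewicz
   inequality L <= C |grad L|^2; together with a descent inequality it shows that
   gradient descent started close enough to the exact network stays close to it
   and that its loss decays geometrically. The good initial values contain a ball,
   which has positive Gaussian probability, so that among K independent
   initializations one is good with probability tending to 1. *)

Set Implicit Arguments.
Unset Strict Implicit.
Unset Printing Implicit Defensive.

Import Order.TTheory GRing.Theory Num.Theory.
Import numFieldNormedType.Exports.

Local Open Scope classical_set_scope.
Local Open Scope ring_scope.

(** * The ReLU and its derivative *)

(** The minimisers are not isolated: a neuron can be rescaled without changing the network, and
    where [f] has no slope jump a neuron of outer weight 0 may have its kink anywhere. The other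
    obstacle is the corner of the ReLU: pointwise, a displacement of size [T] leaves a remainder of
    size [T], not [T ^+ 2]. That remainder lives within a distance of order [T] from a kink, so
    integration supplies the missing factor; hence the descent inequality. In the Lojasiewicz
    inequality the same effect makes the squared norm of the uncancelled part of the error of order
    [T] times the loss, below half the loss once [T] is small. Of the integral this uses only
    linearity, monotonicity and two-sided bounds on the mass of short intervals; the core is
    therefore algebra over a real closed field with an abstract functional. *)

Lemma normr_bool_le1 (R : numDomainType) (c : bool) : `|c%:R : R| <= 1.
Proof. by case: c; rewrite ?normr1 ?normr0. Qed.

Section relu.
Variable R : realFieldType.
Implicit Types x y z : R.

Definition relu y : R := Num.max y 0.
Definition heaviside y : R := (0 < y)%R%:R.

Lemma relu_pos y : 0 <= y -> relu y = y.
Proof. by move=> y0; rewrite /relu max_l. Qed.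

Lemma relu_neg y : y <= 0 -> relu y = 0.
Proof. by move=> y0; rewrite /relu max_r. Qed.

Lemma heaviside_pos y : 0 < y -> heaviside y = 1.
Proof. by rewrite /heaviside => ->. Qed.

Lemma heaviside_neg y : y <= 0 -> heaviside y = 0.
Proof. by rewrite /heaviside leNgt => /negbTE ->. Qed.

Lemma heaviside_norm y : `|heaviside y| <= 1.
Proof. exact: normr_bool_le1. Qed.

Lemma reluM w y : 0 <= w -> relu (w * y) = w * relu y.
Proof. by move=> w0; rewrite /relu maxr_pMr// mulr0. Qed.

Lemma heavisideM w y : 0 < w -> heaviside (w * y) = heaviside y.
Proof. by move=> w0; rewrite /heaviside pmulr_rgt0. Qed.

Lemma relu_lip y z : `|relu z - relu y| <= `|z - y|.
Proof.
case: (lerP 0 y) => hy; case: (lerP 0 z) => hz;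
  rewrite ?(relu_pos hy) ?(relu_pos hz) ?(relu_neg (ltW hy)) ?(relu_neg (ltW hz));
  by rewrite ?subrr ?normr0 ?normr_ge0// ler_norml; case: (ger0P (z - y)) => h;
  apply/andP; split; lra.
Qed.

Lemma relu_norm y : `|relu y| <= `|y|.
Proof. by have := relu_lip 0 y; rewrite (relu_pos (lexx 0)) !subr0. Qed.

(** On either side of 0 the ReLU is affine and the remainder vanishes. Otherwise 0 separates [y]
    from [z], which forces the inequality recorded by the indicator; in a network it turns into
    closeness of [x] to a kink. *)
Lemma relu_taylor y z :
  `|relu z - relu y - heaviside y * (z - y)|
    <= `|z - y| * (`|y| <= `|z - y|)%R%:R.
Proof.
case: (ltrP 0 y) => hy; case: (lerP 0 z) => hz;
  rewrite ?(relu_pos (ltW hy)) ?(relu_neg hy) ?(relu_pos hz) ?(relu_neg (ltW hz))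
    ?(heaviside_pos hy) ?(heaviside_neg hy).
- by rewrite mul1r subrr normr0 mulr_ge0.
- have -> : `|y| <= `|z - y|.
    by rewrite (gtr0_norm hy) [ `|z - y|]ltr0_norm; lra.
  by rewrite mulr1 [ `|z - y|]ltr0_norm ?ler_norml; [apply/andP; split|]; lra.
- have -> : `|y| <= `|z - y|.
    by rewrite (ler0_norm hy) ger0_norm; lra.
  by rewrite mulr1 [ `|z - y|]ger0_norm ?ler_norml; [apply/andP; split|]; lra.
- by rewrite mul0r !subrr normr0 mulr_ge0.
Qed.

(* The error when the kink of a ReLU moves from [k] to [q], to first order. *)
Lemma relu_shift x q k :
  `|relu (x - q) - relu (x - k) + (q - k) * heaviside (x - q)|
    <= `|q - k| * (`|x - k| <= `|q - k|)%R%:R.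
Proof.
case: (ltrP 0 (x - q)) => hy; case: (lerP 0 (x - k)) => hz;
  rewrite ?(relu_pos (ltW hy)) ?(relu_neg hy) ?(relu_pos hz) ?(relu_neg (ltW hz))
    ?(heaviside_pos hy) ?(heaviside_neg hy).
- by rewrite (_ : _ + _ = 0) ?normr0 ?mulr_ge0//; ring.
- have -> : `|x - k| <= `|q - k|.
    by rewrite (ltr0_norm hz) ltr0_norm; lra.
  by rewrite !mulr1 [ `|q - k|]ltr0_norm ?ler_norml; [apply/andP; split|]; lra.
- have -> : `|x - k| <= `|q - k|.
    by rewrite (ger0_norm hz) ger0_norm; lra.
  by rewrite !mulr1 [ `|q - k|]ger0_norm ?ler_norml; [apply/andP; split|]; lra.
- by rewrite mulr0 subrr addr0 normr0 mulr_ge0.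
Qed.

End relu.

(** * Shallow ReLU networks *)

(* Shallow networks whose neurons are numbered by [nat]; only the first [N] of
   them are used. *)
Record params (R : Type) := Params {
  bias : R; weight : nat -> R; offset : nat -> R; outer : nat -> R }.

Section network.
Variables (R : realFieldType) (N : nat).
Implicit Types (t u : params R) (x y T : R).

Definition preact t j x : R := weight t j * x + offset t j.

Definition net t x : R :=
  bias t + \sum_(j < N) outer t j * relu (preact t j x).

Definition params_close T t u : Prop :=
  `|bias t - bias u| <= T /\
  forall j, (j < N)%N -> [/\ `|weight t j - weight u j| <= T,
     `|offset t j - offset u j| <= T & `|outer t j - outer u j| <= T].

(* The derivative of [net ^~ x] at [t] in the direction [u - t], with the value
   0 for the derivative of [relu] at 0. *)
Definition linearization t u x : R :=
  (bias u - bias t) + \sum_(j < N)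
    ((outer u j - outer t j) * relu (preact t j x)
     + ((weight u j - weight t j) * (outer t j * (heaviside (preact t j x) * x))
        + (offset u j - offset t j) * (outer t j * heaviside (preact t j x)))).

Lemma params_close_sym T t u : params_close T t u -> params_close T u t.
Proof.
move=> [h1 h2]; split; first by rewrite distrC.
by move=> j /h2 [? ? ?]; split; rewrite distrC.
Qed.

Lemma params_close_trans T T' t u s :
  params_close T t u -> params_close T' u s -> params_close (T + T') t s.
Proof.
move=> [h1 h2] [h3 h4]; split.
  by rewrite (le_trans (ler_distD (bias u) _ _)) ?lerD.
move=> j jN; have [a1 a2 a3] := h2 j jN; have [b1 b2 b3] := h4 j jN.
by split; [rewrite (le_trans (ler_distD (weight u j) _ _)) ?lerD
  |rewrite (le_trans (ler_distD (offset u j) _ _)) ?lerD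
  |rewrite (le_trans (ler_distD (outer u j) _ _)) ?lerD].
Qed.

Lemma params_close_le T T' t u : T <= T' -> params_close T t u -> params_close T' t u.
Proof.
move=> TT' [h1 h2]; split; first exact: le_trans TT'.
by move=> j /h2 [? ? ?]; split; apply: le_trans TT'.
Qed.

Lemma preact_lip X T t u x j : 1 <= X -> 0 <= T -> `|x| <= X -> params_close T t u ->
  (j < N)%N -> `|preact u j x - preact t j x| <= 2 * X * T.
Proof.
move=> X1 T0 xX [_ /(_ j) h] /h [hw hb _].
have -> : preact u j x - preact t j x =
    (weight u j - weight t j) * x + (offset u j - offset t j).
  by rewrite /preact; ring.
have h1 : `|(weight u j - weight t j) * x| <= T * X.
  by rewrite normrM ler_pM // distrC.
have h2 : `|offset u j - offset t j| <= T by rewrite distrC.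
apply: le_trans (ler_normD _ _) _.
have : T <= X * T by rewrite ler_peMl.
by move=> ?; lra.
Qed.

End network.

(** * Estimates in a box of bounded parameters *)

Section box.
Variables (R : realFieldType) (N : nat) (X V : R).
Hypotheses (X1 : 1 <= X) (V1 : 1 <= V).
Implicit Types (t u : params R) (x y T : R).

Let X_ge0 : 0 <= X := le_trans ler01 X1.
Let V_ge0 : 0 <= V := le_trans ler01 V1.

(** This box contains every point within 1/2 of a reference with weights 1, offsets at most [X] and
    outer weights at most [V]. The lower bound on the weights makes [kink] a quotient with
    controlled denominator. *)
Definition bounded_params t : Prop :=
  forall j, (j < N)%N ->
    [/\ 1 / 2 <= weight t j, `|weight t j| <= 2, `|offset t j| <= 2 * X &
        `|outer t j| <= 2 * V].

Lemma preact_bound t j x : bounded_params t -> `|x| <= X -> (j < N)%N ->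
  `|preact t j x| <= 4 * X.
Proof.
move=> bt xX /bt [_ w2 b2 _]; apply: le_trans (ler_normD _ _) _.
rewrite normrM; have : `|weight t j| * `|x| <= 2 * X by rewrite ler_pM.
by move=> ?; lra.
Qed.

Lemma neuron_lip T t u x j : 0 <= T -> params_close N T t u ->
  bounded_params t -> bounded_params u -> `|x| <= X -> (j < N)%N ->
  `|outer u j * relu (preact u j x) - outer t j * relu (preact t j x)|
    <= 8 * X * V * T.
Proof.
move=> T0 tu bt bu xX jN.
have [_ /(_ j jN) [_ _ hv]] := tu.
have [_ _ _ vV] := bt j jN.
have -> : outer u j * relu (preact u j x) - outer t j * relu (preact t j x) =
   (outer u j - outer t j) * relu (preact u j x)
   + outer t j * (relu (preact u j x) - relu (preact t j x)) by ring.
apply: le_trans (ler_normD _ _) _; rewrite !normrM.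
have h1 : `|outer u j - outer t j| * `|relu (preact u j x)| <= T * (4 * X).
  rewrite distrC in hv; rewrite ler_pM //.
  by apply: le_trans (relu_norm _) _; exact: preact_bound.
have h2 : `|outer t j| * `|relu (preact u j x) - relu (preact t j x)|
    <= (2 * V) * (2 * X * T).
  rewrite ler_pM //; apply: le_trans (relu_lip _ _) _.
  exact: preact_lip tu _.
have X0 := X_ge0; have V0 := V_ge0.
have h3 : T * X <= V * (T * X) by rewrite ler_peMl// mulr_ge0.
nra.
Qed.

Lemma sum_const_ord (c : R) : \sum_(j < N) c = N%:R * c.
Proof. by rewrite sumr_const card_ord mulr_natl. Qed.

Lemma sum_le_const (F : 'I_N -> R) c : (forall j, F j <= c) ->
  \sum_(j < N) F j <= N%:R * c.
Proof.
by move=> h; rewrite -sum_const_ord ler_sum.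
Qed.

Definition lip_const : R := 1 + N%:R * (8 * X * V).

Lemma lip_const_ge1 : 1 <= lip_const.
Proof.
by rewrite /lip_const lerDl !mulr_ge0.
Qed.

Lemma net_lip T t u x : 0 <= T -> params_close N T t u ->
  bounded_params t -> bounded_params u -> `|x| <= X ->
  `|net N u x - net N t x| <= lip_const * T.
Proof.
move=> T0 tu bt bu xX; rewrite /net opprD addrACA -sumrB.
apply: le_trans (ler_normD _ _) _; rewrite /lip_const mulrDl mul1r lerD//.
  by have [h _] := tu; rewrite distrC.
apply: le_trans (ler_norm_sum _ _ _) _; rewrite -mulrA.
by apply: sum_le_const => j; apply: neuron_lip.
Qed.

Definition kink t j : R := - offset t j / weight t j.

(** Outer weight times activation is a product: the remainder is the product of the two increments,
    which is quadratic in [T], plus the outer weight times the remainder of [relu_taylor]. The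
    latter is only linear in [T] but is confined to balls around the kinks whose radius is itself
    proportional to [T]. *)
Lemma net_taylor T t u x : 0 <= T -> params_close N T t u ->
  bounded_params t -> bounded_params u -> `|x| <= X ->
  `|net N u x - net N t x - linearization N t u x| <=
    N%:R * (2 * X * T ^+ 2) +
    (4 * X * V * T) * \sum_(j < N) (`|x - kink t j| <= 4 * X * T)%R%:R.
Proof.
move=> T0 tu bt bu xX.
have X0 := X_ge0; have V0 := V_ge0.
have -> : net N u x - net N t x - linearization N t u x =
  \sum_(j < N) ((outer u j - outer t j) *
                    (relu (preact u j x) - relu (preact t j x))
    + outer t j * (relu (preact u j x) - relu (preact t j x)
       - heaviside (preact t j x) * (preact u j x - preact t j x))).
  rewrite /net /linearization !opprD !addrA.
  rewrite [X in X - _](_ : _ = \sum_(j < N) (outer u j * relu (preact u j x))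
     - \sum_(j < N) (outer t j * relu (preact t j x))); last by ring.
  rewrite -sumrB -sumrB; apply: eq_bigr => j _; rewrite /preact; ring.
apply: le_trans (ler_norm_sum _ _ _) _.
rewrite mulr_sumr -sum_const_ord -big_split /=.
apply: ler_sum => j _.
have [_ /(_ j (ltn_ord j)) [_ _ hv]] := tu.
have [w1 _ _ vV] := bt j (ltn_ord j).
have hz : `|preact u j x - preact t j x| <= 2 * X * T.
  exact: preact_lip tu _.
apply: le_trans (ler_normD _ _) _; rewrite !normrM lerD//.
  have -> : 2 * X * T ^+ 2 = T * (2 * X * T) by ring.
  rewrite distrC in hv; rewrite ler_pM //.
  by apply: le_trans (relu_lip _ _) _.
have -> : 4 * X * V * T * (`|x - kink t j| <= 4 * X * T)%R%:R =
   (2 * V) * ((2 * X * T) * (`|x - kink t j| <= 4 * X * T)%R%:R) by ring.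
rewrite ler_pM //; apply: le_trans (relu_taylor _ _) _.
rewrite ler_pM // ler_nat.
case: (ltrP (4 * X * T)) => h; last exact: leq_b1.
(* Farther than [4 * X * T] from the kink, a weight of at least 1/2 makes the preactivation larger
   than [2 * X * T], the most it can change. *)
suff : `|preact u j x - preact t j x| < `|preact t j x|.
  by rewrite ltNge => /negbTE ->.
apply: le_lt_trans hz _.
have w0 : 0 < weight t j by lra.
have -> : preact t j x = weight t j * (x - kink t j).
  by rewrite /preact /kink; field; rewrite gt_eqF.
have : 1 / 2 * `|x - kink t j| <= weight t j * `|x - kink t j|.
  by rewrite ler_wpM2r.
by rewrite normrM gtr0_norm // => ?; lra.
Qed.

End box.

(** * Weighted integrals *)

(* A positive linear functional on a class of functions on [a, b] which is
   comparable with the Lebesgue measure; [good] stands for bounded and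
   measurable, [J F] for the integral of [F * p]. *)
Record weighted_integral (R : rcfType) (a b Pm PM : R) (good : (R -> R) -> Prop)
    (J : (R -> R) -> R) : Prop := WeightedIntegral {
  Pm_gt0 : 0 < Pm;
  PM_ge0 : 0 <= PM;
  good_cst : forall c : R, good (fun=> c);
  good_id : good (fun x => x);
  good_add : forall F G : R -> R, good F -> good G -> good (fun x => F x + G x);
  good_mul : forall F G : R -> R, good F -> good G -> good (fun x => F x * G x);
  good_relu : forall F : R -> R, good F -> good (fun x => relu (F x));
  good_heaviside : forall F : R -> R, good F -> good (fun x => heaviside (F x));
  good_ball : forall q t : R, good (fun x => (`|x - q| <= t)%R%:R);
  J_add : forall F G : R -> R, good F -> good G ->
    J (fun x => F x + G x) = J F + J G;
  J_scale : forall (c : R) (F : R -> R), good F -> J (fun x => c * F x) = c * J F;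
  J_mono : forall F G : R -> R, good F -> good G ->
    (forall x, a <= x <= b -> F x <= G x) -> J F <= J G;
  J_ball_le : forall q t : R, 0 <= t -> J (fun x => (`|x - q| <= t)%R%:R) <= PM * t;
  J_ball_ge : forall q t : R, 0 <= t -> a <= q - t -> q + t <= b ->
    Pm * t <= J (fun x => (`|x - q| <= t)%R%:R) }.

Section functional.
Variables (R : rcfType) (a b Pm PM : R) (good : (R -> R) -> Prop).
Variables (J : (R -> R) -> R).
Hypothesis hJ : weighted_integral a b Pm PM good J.
Implicit Types F G : R -> R.

Lemma good_sub F G : good F -> good G -> good (fun x => F x - G x).
Proof.
move=> gF gG; have -> : (fun x => F x - G x) = (fun x => F x + (-1) * G x).
  by apply/funext => x; rewrite mulN1r.
by apply: (good_add hJ) => //; apply: (good_mul hJ) => //; apply: (good_cst hJ).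
Qed.

Lemma good_sqr F : good F -> good (fun x => F x ^+ 2).
Proof.
move=> gF; rewrite (_ : (fun _ => _) = (fun x => F x * F x)) //.
exact: (good_mul hJ).
Qed.

Lemma good_sum I (s : seq I) (F : I -> R -> R) : (forall i, good (F i)) ->
  good (fun x => \sum_(i <- s) F i x).
Proof.
move=> gF; elim: s => [|i s IH].
  rewrite (_ : (fun _ => _) = (fun=> 0)); first exact: (good_cst hJ).
  by apply/funext => x; rewrite big_nil.
rewrite (_ : (fun _ => _) = (fun x => F i x + \sum_(j <- s) F j x)).
  exact: (good_add hJ).
by apply/funext => x; rewrite big_cons.
Qed.

Lemma J_cst (c : R) : J (fun=> c) = c * J (fun=> 1).
Proof.
rewrite -(J_scale hJ); last exact: (good_cst hJ).
by congr J; apply/funext => x; rewrite mulr1.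
Qed.

Lemma J_sum I (s : seq I) (F : I -> R -> R) : (forall i, good (F i)) ->
  J (fun x => \sum_(i <- s) F i x) = \sum_(i <- s) J (F i).
Proof.
move=> gF; elim: s => [|i s IH].
  rewrite (_ : (fun _ => _) = (fun=> 0)); first by rewrite big_nil J_cst mul0r.
  by apply/funext => x; rewrite big_nil.
rewrite (_ : (fun _ => _) = (fun x => F i x + \sum_(j <- s) F j x)).
  by rewrite big_cons (J_add hJ) ?IH //; exact: good_sum.
by apply/funext => x; rewrite big_cons.
Qed.

Lemma J_sub F G : good F -> good G -> J (fun x => F x - G x) = J F - J G.
Proof.
move=> gF gG; have -> : (fun x => F x - G x) = (fun x => F x + (-1) * G x).
  by apply/funext => x; rewrite mulN1r.
rewrite (J_add hJ) ?(J_scale hJ) ?mulN1r //.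
by apply: (good_mul hJ) => //; apply: (good_cst hJ).
Qed.

Lemma J_ge0 F : good F -> (forall x, a <= x <= b -> 0 <= F x) -> 0 <= J F.
Proof.
move=> gF F0; rewrite -[leLHS](mul0r (J (fun=> 1))) -J_cst.
by apply: (J_mono hJ) => //; apply: (good_cst hJ).
Qed.

Lemma J1_ge0 : 0 <= J (fun=> 1).
Proof. by apply: J_ge0 => //; apply: (good_cst hJ). Qed.

Lemma J_sqr_ge0 F : good F -> 0 <= J (fun x => F x ^+ 2).
Proof. by move=> gF; apply: J_ge0 => [|x _]; [exact: good_sqr|exact: sqr_ge0]. Qed.

(** Expand the integral of the square of [K * F - B * G], where [B] is the integral of [F * G]. The
    positive bound [K] stands in for the integral of [G ^+ 2], which avoids a case distinction when
    the latter vanishes. *)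
Lemma J_cauchy F G (K : R) : good F -> good G -> 0 < K -> J (fun x => G x ^+ 2) <= K ->
  J (fun x => F x * G x) ^+ 2 <= J (fun x => F x ^+ 2) * K.
Proof.
move=> gF gG K0 GK; set B := J (fun x => F x * G x).
set A := J (fun x => F x ^+ 2).
have gc c : good (fun=> c) := good_cst hJ c.
have gFG : good (fun x => F x * G x) by exact: (good_mul hJ).
have gcM c H : good H -> good (fun x => c * H x).
  by move=> gH; exact: (good_mul hJ).
have : 0 <= J (fun x => (K * F x - B * G x) ^+ 2).
  by apply: J_sqr_ge0; apply: good_sub; apply: gcM.
have -> : (fun x => (K * F x - B * G x) ^+ 2) =
    (fun x => (K ^+ 2 * F x ^+ 2 + (- (2 * K * B)) * (F x * G x))
        + B ^+ 2 * G x ^+ 2).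
  by apply/funext => x; ring.
rewrite !(J_add hJ) ?(J_scale hJ) //; first last.
all: do ?[exact: good_sqr | exact: gFG | apply: gcM | apply: (good_add hJ)].
rewrite -/A -/B => h.
have : B ^+ 2 * J (fun x => G x ^+ 2) <= B ^+ 2 * K.
  by rewrite ler_wpM2l // sqr_ge0.
move=> h2; rewrite -(ler_pM2l K0).
nra.
Qed.

Lemma J_bound F G (M : R) : good F -> good G -> 0 <= M ->
  (forall x, a <= x <= b -> `|G x| <= M) ->
  `|J (fun x => F x * G x)| <=
    (M + 1) * (1 + J (fun=> 1)) * Num.sqrt (J (fun x => F x ^+ 2)).
Proof.
move=> gF gG M0 GM; have J1 := J1_ge0.
(* Its square dominates [M ^+ 2 * J (fun=> 1)]; the added ones keep it positive and spare a root of
   [J (fun=> 1)]. *)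
set K := (M + 1) * (1 + J (fun=> 1)).
have K0 : 0 < K by rewrite mulr_gt0 //; lra.
have A0 := J_sqr_ge0 gF.
have K1 : 0 <= K by exact: ltW.
rewrite -ler_sqr ?nnegrE ?normr_ge0 ?(mulr_ge0 K1) ?sqrtr_ge0 //.
rewrite exprMn sqr_sqrtr // real_normK ?num_real // [leRHS]mulrC.
apply: J_cauchy => //; first by rewrite exprn_gt0.
apply: le_trans (_ : J (fun=> M ^+ 2) <= _).
  apply: (J_mono hJ); [exact: good_sqr|exact: (good_cst hJ)|].
  move=> x /GM h; rewrite -real_normK ?num_real // lerXn2r ?nnegrE //.
rewrite J_cst /K exprMn; apply: ler_pM => //; first exact: sqr_ge0.
  by rewrite lerXn2r ?nnegrE //; lra.
by rewrite expr2; nra.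
Qed.

(* On a short interval an affine function is at least half as large as at the
   endpoint where it is largest. *)
Lemma affine_coef_bound (l r X m k : R) E : good E ->
  0 < r -> r <= 1 -> 1 <= X -> a <= l -> l + r <= b -> `|l| <= X ->
  (forall x, l <= x <= l + r -> E x = m * x + k) ->
  let C := (3 * X / r) * (1 + 32 / (Pm * r)) in
  `|m| <= C * Num.sqrt (J (fun x => E x ^+ 2)) /\
  `|k| <= C * Num.sqrt (J (fun x => E x ^+ 2)).
Proof.
move=> gE r0 r1 X1 al lb lX EE C; set S := Num.sqrt _.
have Pm0 := Pm_gt0 hJ.
have L0 := J_sqr_ge0 gE.
have S0 : 0 <= S by exact: sqrtr_ge0.
pose D := 1 + 32 / (Pm * r).
have Dpos : 0 < 32 / (Pm * r) by rewrite divr_gt0 // mulr_gt0.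
have D1 : 1 <= D by rewrite /D; lra.
have key (M c : R) : 0 <= M -> a <= c - r / 8 -> c + r / 8 <= b ->
    (forall x, `|x - c| <= r / 8 -> M / 2 <= `|E x|) -> M <= D * S.
  move=> M0 ac cb h.
  have : M ^+ 2 / 4 * (Pm * (r / 8)) <= S ^+ 2.
    rewrite sqr_sqrtr //.
    apply: le_trans (_ : M ^+ 2 / 4 * J (fun x => (`|x - c| <= r / 8)%R%:R) <= _).
      rewrite ler_wpM2l ?divr_ge0 ?sqr_ge0 //; apply: (J_ball_ge hJ) => //.
      by rewrite divr_ge0 // ltW.
    rewrite -(J_scale hJ); last exact: (good_ball hJ).
    apply: (J_mono hJ).
    - by apply: (good_mul hJ); [exact: (good_cst hJ)|exact: (good_ball hJ)].
    - exact: good_sqr.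
    move=> x _; have [/h hx|_] := boolP (`|x - c| <= _); last by rewrite mulr0 sqr_ge0.
    rewrite mulr1 -[E x ^+ 2]real_normK ?num_real //.
    have -> : M ^+ 2 / 4 = (M / 2) ^+ 2 by field.
    by rewrite lerXn2r ?nnegrE // divr_ge0.
  move=> hS.
  have h2 : M ^+ 2 <= (32 / (Pm * r)) * S ^+ 2.
    have -> : M ^+ 2 = (32 / (Pm * r)) * (M ^+ 2 / 4 * (Pm * (r / 8))).
      by field; rewrite ?gt_eqF.
    by rewrite ler_wpM2l // ltW.
  rewrite -ler_sqr ?nnegrE //; last by rewrite mulr_ge0 //; lra.
  rewrite exprMn; apply: le_trans h2 _; rewrite ler_wpM2r ?sqr_ge0 //.
  rewrite /D; nra.
(* Over the quarter of the interval next to the better endpoint, [E] changes by at most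
   [|m| * r / 4], hence by at most [M / 2]. That quarter is a ball of radius [r / 8]. *)
have both (M : R) : 0 <= M -> (`|m * l + k| = M /\ `|m| * r <= 2 * M) \/
    (`|m * (l + r) + k| = M /\ `|m| * r <= 2 * M) -> M <= D * S.
  move=> M0 [[hM hm]|[hM hm]].
  - apply: (key M (l + r / 8)) => //; [lra|lra|move=> x hx].
    have /andP[x1 x2] : l <= x <= l + r / 4.
      by move: hx; rewrite ler_distl => /andP[]; move=> *; apply/andP; split; lra.
    rewrite EE; last by apply/andP; split; lra.
    have -> : m * x + k = (m * l + k) - m * (l - x) by ring.
    apply: le_trans _ (lerB_dist _ _); rewrite hM normrM.
    have : `|l - x| <= r / 4 by rewrite ler_distl; apply/andP; split; lra.
    move=> /(ler_wpM2l (normr_ge0 m)); lra.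
  - apply: (key M (l + r - r / 8)) => //; [lra|lra|move=> x hx].
    have /andP[x1 x2] : l + r - r / 4 <= x <= l + r.
      by move: hx; rewrite ler_distl => /andP[]; move=> *; apply/andP; split; lra.
    rewrite EE; last by apply/andP; split; lra.
    have -> : m * x + k = (m * (l + r) + k) - m * (l + r - x) by ring.
    apply: le_trans _ (lerB_dist _ _); rewrite hM normrM.
    have : `|l + r - x| <= r / 4 by rewrite ler_distl; apply/andP; split; lra.
    move=> /(ler_wpM2l (normr_ge0 m)); lra.
pose M := Num.max `|m * l + k| `|m * (l + r) + k|.
have hm : `|m| * r <= 2 * M.
  rewrite -{1}(gtr0_norm r0) -normrM.
  have -> : m * r = (m * (l + r) + k) - (m * l + k) by ring.
  apply: le_trans (ler_normB _ _) _.
  have : `|m * l + k| <= M by rewrite le_max lexx.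
  have : `|m * (l + r) + k| <= M by rewrite le_max lexx orbT.
  by move=> ? ?; lra.
have M0 : 0 <= M by rewrite le_max normr_ge0.
have MDS : M <= D * S.
  apply: both => //; rewrite /M; case: (lerP `|m * l + k|) => h.
    by right; split => //; move: hm; rewrite /M max_r.
  by left; split => //; move: hm; rewrite /M max_l // ltW.
have CE : C * S = 3 * X / r * (D * S) by rewrite /C /D; ring.
have mM : `|m| <= 2 / r * M.
  have -> : 2 / r * M = (2 * M) / r by ring.
  by rewrite ler_pdivlMr.
have rV : 1 <= r^-1 by rewrite invf_ge1.
have Y0 : 0 <= r^-1 * M by rewrite mulr_ge0 // ltW // invr_gt0.
have YX : r^-1 * M <= X * (r^-1 * M) by rewrite ler_peMl.
have MX : M <= X * (r^-1 * M).
  by apply: le_trans YX; rewrite ler_peMl.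
have C3 : 3 * (X * (r^-1 * M)) <= C * S.
  have -> : 3 * (X * (r^-1 * M)) = 3 * X / r * M by ring.
  by rewrite CE ler_wpM2l // !mulr_ge0 // ?invr_ge0 ?ltW //; lra.
have mE : 2 / r * M = 2 * (r^-1 * M) by ring.
split; first by rewrite mE in mM; lra.
have -> : k = (m * l + k) - m * l by ring.
apply: le_trans (ler_normB _ _) _.
have h1 : `|m * l + k| <= M by rewrite le_max lexx.
have h2 : `|m * l| <= (2 / r * M) * X by rewrite normrM ler_pM.
have h3 : (2 / r * M) * X = 2 * (X * (r^-1 * M)) by ring.
lra.
Qed.

End functional.

(** * Loss and descent inequality *)

Section loss.
Variables (R : rcfType) (a b Pm PM : R) (good : (R -> R) -> Prop).
Variables (J : (R -> R) -> R).
Hypothesis hJ : weighted_integral a b Pm PM good J.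
Variables (N : nat) (X V : R) (ref : params R).
Hypotheses (X1 : 1 <= X) (V1 : 1 <= V).
Hypothesis hX : forall x, a <= x <= b -> `|x| <= X.
Hypothesis weight_ref : forall j, (j < N)%N -> weight ref j = 1.
Hypothesis offset_ref : forall j, (j < N)%N -> `|offset ref j| <= X.
Hypothesis outer_ref : forall j, (j < N)%N -> `|outer ref j| <= V.
Implicit Types (t u : params R) (x T : R).

Let X_ge0 : 0 <= X := le_trans ler01 X1.
Let V_ge0 : 0 <= V := le_trans ler01 V1.

Definition err t x : R := net N t x - net N ref x.
Definition loss t : R := J (fun x => err t x ^+ 2).

(** A formal gradient, with [heaviside] for the derivative of [relu]; it is not claimed to be a
    derivative of [loss] at every point. It is stored as a parameter record, so [weight] of it is
    the family of partial derivatives in the inner weights, and so on. *)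
Definition loss_grad t : params R := Params
  (2 * J (err t))
  (fun j => 2 * J (fun x => err t x * (outer t j * (heaviside (preact t j x) * x))))
  (fun j => 2 * J (fun x => err t x * (outer t j * heaviside (preact t j x))))
  (fun j => 2 * J (fun x => err t x * relu (preact t j x))).

Definition gd_step (gamma : R) t : params R := let g := loss_grad t in Params
  (bias t - gamma * bias g)
  (fun j => weight t j - gamma * weight g j)
  (fun j => offset t j - gamma * offset g j)
  (fun j => outer t j - gamma * outer g j).

Definition sqnorm (g : params R) : R := bias g ^+ 2 +
  \sum_(j < N) (outer g j ^+ 2 + (weight g j ^+ 2 + offset g j ^+ 2)).

Lemma sqnorm_ge0 g : 0 <= sqnorm g.
Proof. by rewrite addr_ge0 ?sqr_ge0 ?sumr_ge0 // => j _; rewrite !addr_ge0 ?sqr_ge0. Qed.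

Definition coord_le (M : R) (g : params R) : Prop := `|bias g| <= M /\
  forall j, (j < N)%N -> [/\ `|weight g j| <= M, `|offset g j| <= M & `|outer g j| <= M].

Lemma coord_le_sqnorm g : coord_le (Num.sqrt (sqnorm g)) g.
Proof.
have aux y : y ^+ 2 <= sqnorm g -> `|y| <= Num.sqrt (sqnorm g).
  by move=> h; rewrite -sqrtr_sqr ler_wsqrtr.
split.
  apply: aux; rewrite /sqnorm lerDl sumr_ge0 // => j _.
  by rewrite !addr_ge0 ?sqr_ge0.
move=> j jN.
have h : outer g j ^+ 2 + (weight g j ^+ 2 + offset g j ^+ 2) <= sqnorm g.
  rewrite /sqnorm (bigD1 (Ordinal jN)) //= [leRHS]addrCA lerDl addr_ge0 ?sqr_ge0 //.
  by rewrite sumr_ge0 // => i _; rewrite !addr_ge0 ?sqr_ge0.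
have := sqr_ge0 (outer g j); have := sqr_ge0 (weight g j).
have := sqr_ge0 (offset g j); move=> h1 h2 h3.
by split; apply: aux; lra.
Qed.

Lemma good_preact t j : good (preact t j).
Proof.
apply: (good_add hJ); last exact: (good_cst hJ).
by apply: (good_mul hJ); [exact: (good_cst hJ)|exact: (good_id hJ)].
Qed.

Lemma good_net t : good (net N t).
Proof.
apply: (good_add hJ); first exact: (good_cst hJ).
apply: (good_sum hJ) => j; apply: (good_mul hJ); first exact: (good_cst hJ).
by apply: (good_relu hJ); exact: good_preact.
Qed.

Lemma good_err t : good (err t).
Proof. by apply: (good_sub hJ); exact: good_net. Qed.

Lemma good_outer_partial t j : good (fun x => relu (preact t j x)).
Proof. by apply: (good_relu hJ); exact: good_preact. Qed.

Lemma good_offset_partial t j : good (fun x => outer t j * heaviside (preact t j x)).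
Proof.
apply: (good_mul hJ); first exact: (good_cst hJ).
by apply: (good_heaviside hJ); exact: good_preact.
Qed.

Lemma good_weight_partial t j :
  good (fun x => outer t j * (heaviside (preact t j x) * x)).
Proof.
apply: (good_mul hJ); first exact: (good_cst hJ).
apply: (good_mul hJ); last exact: (good_id hJ).
by apply: (good_heaviside hJ); exact: good_preact.
Qed.

Let good_scale (c : R) F : good F -> good (fun x => c * F x).
Proof. by move=> gF; apply: (good_mul hJ) => //; exact: (good_cst hJ). Qed.

Lemma good_linearization t u : good (linearization N t u).
Proof.
apply: (good_add hJ); first exact: (good_cst hJ).
apply: (good_sum hJ) => j; apply: (good_add hJ).
  by apply: good_scale; exact: good_outer_partial.
by apply: (good_add hJ); apply: good_scale;
  [exact: good_weight_partial|exact: good_offset_partial].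
Qed.

(** The bridge between the error as a function and the gradient in parameter space. It is used in
    two directions: towards the next iterate for the descent inequality, and towards [pl_dir] for
    the Lojasiewicz inequality. *)
Lemma linearization_grad t u (g := loss_grad t) :
  2 * J (fun x => err t x * linearization N t u x) =
  (bias u - bias t) * bias g + \sum_(j < N)
    ((outer u j - outer t j) * outer g j
      + ((weight u j - weight t j) * weight g j
        + (offset u j - offset t j) * offset g j)).
Proof.
pose H (j : nat) x := err t x * ((outer u j - outer t j) * relu (preact t j x)
     + ((weight u j - weight t j) * (outer t j * (heaviside (preact t j x) * x))
        + (offset u j - offset t j) * (outer t j * heaviside (preact t j x)))).
have ge := good_err t.
have gH j : good (H j).
  apply: (good_mul hJ) => //; apply: (good_add hJ).
    by apply: good_scale; exact: good_outer_partial.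
  by apply: (good_add hJ); apply: good_scale;
    [exact: good_weight_partial|exact: good_offset_partial].
have -> : (fun x => err t x * linearization N t u x) =
    (fun x => (bias u - bias t) * err t x + \sum_(j < N) H j x).
  by apply/funext => x; rewrite /linearization mulrDr mulr_sumr mulrC.
rewrite (J_add hJ) ?(J_scale hJ) ?(J_sum hJ) //; last 2 first.
  - exact: good_scale.
  - exact: (good_sum hJ).
rewrite mulrDr mulr_sumr /=; congr (_ + _); first by ring.
apply: eq_bigr => j _.
have -> : H j = (fun x => ((outer u j - outer t j) * (err t x * relu (preact t j x)))
     + (((weight u j - weight t j) * (err t x * (outer t j * (heaviside (preact t j x) * x))))
        + ((offset u j - offset t j) * (err t x * (outer t j * heaviside (preact t j x)))))).
  by apply/funext => x; rewrite /H; ring.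
have g1 := good_mul hJ ge (good_outer_partial t j).
have g2 := good_mul hJ ge (good_weight_partial t j).
have g3 := good_mul hJ ge (good_offset_partial t j).
rewrite !(J_add hJ) ?(J_scale hJ) //; do ?[exact: good_scale | apply: (good_add hJ)].
by ring.
Qed.

Lemma linearization_grad_le t u M : 0 <= M -> params_close N M t u ->
  `|2 * J (fun x => err t x * linearization N t u x)|
    <= (1 + N%:R * 3) * M * Num.sqrt (sqnorm (loss_grad t)).
Proof.
move=> M0 [hb tu]; set S := Num.sqrt _.
have [gb gj] := coord_le_sqnorm (loss_grad t).
rewrite linearization_grad; apply: le_trans (ler_normD _ _) _.
have -> : (1 + N%:R * 3) * M * S = M * S + N%:R * (3 * (M * S)) by ring.
rewrite lerD //; first by rewrite normrM ler_pM // distrC.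
apply: le_trans (ler_norm_sum _ _ _) _.
apply: sum_le_const => j.
have [h1 h2 h3] := tu j (ltn_ord j); have [k1 k2 k3] := gj j (ltn_ord j).
rewrite distrC in h1; rewrite distrC in h2; rewrite distrC in h3.
have l1 := ler_pM (normr_ge0 _) (normr_ge0 _) h1 k1.
have l2 := ler_pM (normr_ge0 _) (normr_ge0 _) h2 k2.
have l3 := ler_pM (normr_ge0 _) (normr_ge0 _) h3 k3.
rewrite -!normrM in l1 l2 l3.
apply: le_trans (ler_normD _ _) _.
apply: le_trans (lerD (lexx _) (ler_normD _ _)) _.
by rewrite -/S in l1 l2 l3 *; lra.
Qed.

Lemma close_bounded t : params_close N (1 / 2) t ref -> bounded_params N X V t.
Proof.
move=> [_ h] j jN; have [] := h j jN; rewrite weight_ref // => h1 h2 h3.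
have X1' := X1; have V1' := V1.
have k2 := offset_ref jN; have k3 := outer_ref jN.
split.
- by move: h1; rewrite ler_distl => /andP[*]; lra.
- by rewrite ler_norml; move: h1; rewrite ler_distl => /andP[*]; apply/andP; split; lra.
- have := lerB_dist (offset t j) (offset ref j); lra.
- have := lerB_dist (outer t j) (outer ref j); lra.
Qed.

Lemma close_ref (T : R) : 0 <= T -> params_close N T ref ref.
Proof. by move=> T0; split=> [|j jN]; rewrite ?subrr ?normr0. Qed.

Let K := lip_const N X V.

Let K_ge1 : 1 <= K.
Proof. exact: lip_const_ge1. Qed.

Lemma err_le t T x : 0 <= T -> T <= 1 / 2 -> params_close N T t ref -> a <= x <= b ->
  `|err t x| <= K * T.
Proof.
move=> T0 T2 tr /hX xX; rewrite /err.
have ref2 : params_close N (1 / 2) ref ref by apply: close_ref; lra.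
by apply: (@net_lip _ N X V) => //; [exact: params_close_sym|
  exact: close_bounded|exact: close_bounded (params_close_le T2 tr)].
Qed.

Lemma loss_le t T : 0 <= T -> T <= 1 / 2 -> params_close N T t ref ->
  loss t <= (K * T) ^+ 2 * J (fun=> 1).
Proof.
move=> T0 T2 tr; rewrite -(J_cst hJ); apply: (J_mono hJ).
- by apply: (good_sqr hJ); exact: good_err.
- exact: (good_cst hJ).
move=> x xab; have h := err_le T0 T2 tr xab.
by rewrite -real_normK ?num_real // lerXn2r ?nnegrE // (le_trans _ h).
Qed.

Lemma loss_ge0 t : 0 <= loss t.
Proof. by apply: (J_sqr_ge0 hJ); exact: good_err. Qed.

(** Each component integrates the error against a function bounded by [4 * X * V], so Cauchy-Schwarz
    applies. A gradient step is therefore no longer than a multiple of the root of the loss, which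
    makes the total path length summable. *)
Lemma grad_le t : params_close N (1 / 2) t ref ->
  coord_le (2 * ((4 * X * V + 1) * (1 + J (fun=> 1))) * Num.sqrt (loss t))
    (loss_grad t).
Proof.
move=> tr; have bt := close_bounded tr.
have ge := good_err t; have J1 := J1_ge0 hJ.
have X1' := X1; have V1' := V1; have X0 := X_ge0; have V0 := V_ge0.
have XV0 : 0 <= 4 * X * V by rewrite !mulr_ge0.
have aux G : good G -> (forall x, a <= x <= b -> `|G x| <= 4 * X * V) ->
  `|2 * J (fun x => err t x * G x)| <=
   2 * ((4 * X * V + 1) * (1 + J (fun=> 1))) * Num.sqrt (loss t).
  move=> gG hG; rewrite normrM ger0_norm // -mulrA ler_wpM2l //.
  exact: (J_bound hJ).
have V1X : V <= X * V by rewrite ler_peMl.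
have X1V : X <= X * V by rewrite ler_peMr.
split=> /=.
  have -> : err t = (fun x => err t x * 1) by apply/funext => x; rewrite mulr1.
  apply: aux; first exact: (good_cst hJ).
  by move=> x _; rewrite normr1; lra.
move=> j jN; have [w1 w2 b2 v2] := bt j jN; split; apply: aux => /=.
- exact: good_weight_partial.
- move=> x /hX xX; rewrite !normrM.
  have h1 := heaviside_norm (preact t j x).
  have h2 : `|heaviside (preact t j x)| * `|x| <= 1 * X by rewrite ler_pM.
  have h3 := ler_pM (normr_ge0 _) (mulr_ge0 (normr_ge0 _) (normr_ge0 _)) v2 h2.
  by apply: le_trans h3 _; lra.
- exact: good_offset_partial.
- move=> x /hX xX; rewrite !normrM.
  have h1 := heaviside_norm (preact t j x).
  have h3 := ler_pM (normr_ge0 _) (normr_ge0 _) v2 h1.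
  by apply: le_trans h3 _; lra.
- exact: good_outer_partial.
- move=> x /hX xX; apply: le_trans (relu_norm _) _.
  by apply: le_trans (preact_bound bt xX jN) _; lra.
Qed.

(** The summand [K ^+ 2] is the squared increment of the network. The other two are the quadratic
    part and the kink part of the remainder in [net_taylor], multiplied by twice the bound [K / 2]
    for the error in the box. *)
Definition descent_const : R :=
  (K * (N%:R * (2 * X)) + K ^+ 2) * J (fun=> 1)
  + K * (4 * X * V) * (N%:R * (PM * (4 * X))).

Lemma descent_const_ge0 : 0 <= descent_const.
Proof.
have J1 := J1_ge0 hJ; have X0 := X_ge0; have V0 := V_ge0; have P0 := PM_ge0 hJ.
have K0 : 0 <= K by apply: le_trans K_ge1.
by rewrite addr_ge0 // ?(mulr_ge0, addr_ge0).
Qed.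

(** Expanding the square leaves the squared increment, of order [T ^+ 2], and the error times the
    remainder of [net_taylor]. Where this remainder is only of order [T], it sits on balls of radius
    [4 * X * T], and [J_ball_le] contributes the second factor. *)
Lemma loss_taylor t u T : 0 <= T -> params_close N T t u ->
  params_close N (1 / 2) t ref -> params_close N (1 / 2) u ref ->
  loss u <= loss t + 2 * J (fun x => err t x * linearization N t u x)
    + descent_const * T ^+ 2.
Proof.
move=> T0 tu tr ur.
have bt := close_bounded tr; have bu := close_bounded ur.
have X0 := X_ge0; have V0 := V_ge0; have P0 := PM_ge0 hJ.
have K1 := K_ge1; have K0 : 0 <= K by apply: le_trans K_ge1.
pose ind (j : 'I_N) x : R := (`|x - kink t j| <= 4 * X * T)%R%:R.
pose A := (K * (N%:R * (2 * X)) + K ^+ 2) * T ^+ 2.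
pose B := K * (4 * X * V) * T.
have A0 : 0 <= A by rewrite mulr_ge0 ?sqr_ge0 // addr_ge0 ?sqr_ge0 // !mulr_ge0.
have B0 : 0 <= B by rewrite !mulr_ge0.
have gl : good (fun x => err t x * linearization N t u x).
  by apply: (good_mul hJ); [exact: good_err|exact: good_linearization].
have gi : good (fun x => \sum_(j < N) ind j x).
  by apply: (good_sum hJ) => j; exact: (good_ball hJ).
have ge2 s : good (fun x => err s x ^+ 2).
  by apply: (good_sqr hJ); exact: good_err.
have pw x : a <= x <= b -> err u x ^+ 2 <=
   (err t x ^+ 2 + 2 * (err t x * linearization N t u x))
   + (A + B * \sum_(j < N) ind j x).
  move=> xab; have xX := hX xab.
  have h1 : `|err t x| <= K.
    have h : `|err t x| <= K * (1 / 2) by apply: err_le => //; lra.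
    by lra.
  have h2 : `|err u x - err t x| <= K * T.
    have -> : err u x - err t x = net N u x - net N t x by rewrite /err; ring.
    exact: net_lip.
  set rho := err u x - err t x - linearization N t u x.
  have h3 : `|rho| <= N%:R * (2 * X * T ^+ 2) + (4 * X * V * T) * \sum_(j < N) ind j x.
    have -> : rho = net N u x - net N t x - linearization N t u x.
      by rewrite /rho /err; ring.
    exact: net_taylor.
  have h4 : (err u x - err t x) ^+ 2 <= (K * T) ^+ 2.
    by rewrite -real_normK ?num_real // lerXn2r ?nnegrE // mulr_ge0.
  have h5 : err t x * rho <= (K / 2) *
      (N%:R * (2 * X * T ^+ 2) + (4 * X * V * T) * \sum_(j < N) ind j x).
    apply: le_trans (ler_norm _) _; rewrite normrM ler_pM //.
    have h : `|err t x| <= K * (1 / 2) by apply: err_le => //; lra.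
    by lra.
  have -> : err u x ^+ 2 = err t x ^+ 2 + 2 * (err t x * linearization N t u x)
     + 2 * (err t x * rho) + (err u x - err t x) ^+ 2 by rewrite /rho; ring.
  have -> : A + B * \sum_(j < N) ind j x =
     2 * ((K / 2) * (N%:R * (2 * X * T ^+ 2) + (4 * X * V * T) * \sum_(j < N) ind j x))
     + (K * T) ^+ 2 by rewrite /A /B; field.
  lra.
have gg1 : good (fun x => err t x ^+ 2 + 2 * (err t x * linearization N t u x)).
  by apply: (good_add hJ) => //; exact: good_scale.
have gg2 : good (fun x => A + B * \sum_(j < N) ind j x).
  by apply: (good_add hJ); [exact: (good_cst hJ)|exact: good_scale].
apply: le_trans (J_mono hJ (ge2 u) (good_add hJ gg1 gg2) pw) _.
rewrite (J_add hJ) // (J_add hJ) //; last exact: good_scale.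
rewrite (J_scale hJ) // lerD2l.
rewrite (J_add hJ); [|exact: (good_cst hJ)|exact: good_scale].
rewrite (J_cst hJ A) (J_scale hJ) // (J_sum hJ); last by move=> j; exact: (good_ball hJ).
have h : \sum_(j < N) J (ind j) <= N%:R * (PM * (4 * X * T)).
  by apply: sum_le_const => j; apply: (J_ball_le hJ); rewrite !mulr_ge0.
have := ler_wpM2l B0 h.
by rewrite /descent_const /A /B => ?; lra.
Qed.

Lemma gd_step_close gamma t M : 0 <= gamma -> coord_le M (loss_grad t) ->
  params_close N (gamma * M) t (gd_step gamma t).
Proof.
move=> g0 [hb hj]; split=> /=.
  by rewrite subKr normrM ger0_norm // ler_wpM2l.
by move=> j /hj [h1 h2 h3]; split; rewrite subKr normrM ger0_norm // ler_wpM2l.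
Qed.

Lemma loss_descent gamma t : 0 <= gamma ->
  params_close N (1 / 2) t ref -> params_close N (1 / 2) (gd_step gamma t) ref ->
  loss (gd_step gamma t) <= loss t
    - (gamma - descent_const * gamma ^+ 2) * sqnorm (loss_grad t).
Proof.
move=> g0 tr ur; set u := gd_step gamma t.
pose S := Num.sqrt (sqnorm (loss_grad t)).
have tu : params_close N (gamma * S) t u := gd_step_close g0 (coord_le_sqnorm _).
apply: le_trans (loss_taylor _ tu tr ur) _; first by rewrite mulr_ge0 ?sqrtr_ge0.
rewrite exprMn sqr_sqrtr ?sqnorm_ge0 // linearization_grad.
suff -> : (bias u - bias t) * bias (loss_grad t) + \sum_(j < N)
    ((outer u j - outer t j) * outer (loss_grad t) j
      + ((weight u j - weight t j) * weight (loss_grad t) j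
        + (offset u j - offset t j) * offset (loss_grad t) j)) =
   - (gamma * sqnorm (loss_grad t)) by lra.
rewrite /sqnorm mulrDr opprD mulr_sumr -sumrN; congr (_ + _).
  by rewrite /u /gd_step; set g := loss_grad t; simpl; ring.
apply: eq_bigr => j _.
by rewrite /u /gd_step; set g := loss_grad t; simpl; ring.
Qed.

End loss.

(** * Lojasiewicz inequality and convergence *)

Section lojasiewicz.
Variables (R : rcfType) (a b Pm PM : R) (good : (R -> R) -> Prop).
Variables (J : (R -> R) -> R).
Hypothesis hJ : weighted_integral a b Pm PM good J.
Variables (N : nat) (X V r m0 cst : R) (kap alp l : nat -> R).
Hypotheses (N0 : (0 < N)%N) (X1 : 1 <= X) (V1 : 1 <= V).
Hypotheses (r0 : 0 < r) (r1 : r <= 1) (m00 : 0 < m0).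
Hypothesis hX : forall x, a <= x <= b -> `|x| <= X.
Hypothesis kapX : forall j, (j < N)%N -> `|kap j| <= X.
Hypothesis alpV : forall j, (j < N)%N -> `|alp j| <= V.
Hypothesis alp_m0 : forall j, (j < N)%N -> alp j != 0 -> 2 * m0 <= `|alp j|.
Hypothesis kap0 : kap 0%N + r <= a.
Hypothesis la : forall j, (j < N)%N -> a <= l j.
Hypothesis lb : forall j, (j < N)%N -> l j + r <= b.
Hypothesis kap_left : forall i j, (i <= j)%N -> (j < N)%N -> kap i + r / 2 <= l j.
Hypothesis kap_right : forall i j, (j < i)%N -> (i < N)%N -> l j + r <= kap i - r / 2.
Implicit Types (t u : params R) (x T : R).

Definition target : params R := Params cst (fun=> 1) (fun j => - kap j) alp.

Let X_ge0 : 0 <= X := le_trans ler01 X1.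
Let V_ge0 : 0 <= V := le_trans ler01 V1.
Let weight_ref j : (j < N)%N -> weight target j = 1. Proof. by []. Qed.
Let offset_ref j : (j < N)%N -> `|offset target j| <= X.
Proof. by move=> jN; rewrite normrN kapX. Qed.
Let outer_ref j : (j < N)%N -> `|outer target j| <= V.
Proof. exact: alpV. Qed.

Local Notation err := (err N target).
Local Notation loss := (loss J N target).
Local Notation loss_grad := (loss_grad J N target).
Local Notation gd_step := (gd_step J N target).

Section at_params.
Variables (t : params R) (T : R).
Hypotheses (T0 : 0 <= T) (tT : params_close N T t target).
Hypotheses (T2 : T <= 1 / 2) (Tm0 : T <= m0) (Tr : 8 * X * T <= r).

Let q j := kink t j.
(** To the right of both kinks, neuron [j] minus its target is [sig j * (x - q j) - alp j * d j]: an
    error in slope and one in the position of the kink. Neuron 0 has its kink to the left of [a], so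
    its displacement only shifts a constant; it is moved into [C0], and [beta] is 0 there. *)
Let sig j := outer t j * weight t j - alp j.
Let d j := q j - kap j.
Let beta (j : nat) : R := if j == 0%N then 0 else alp j * d j.
Let C0 := bias t - cst - alp 0%N * d 0%N.
Let S : R := Num.sqrt (loss t).

Let bt : bounded_params N X V t.
Proof.
exact: (close_bounded X1 V1 weight_ref offset_ref outer_ref
  (params_close_le T2 tT)).
Qed.

Let weight_gt0 j : (j < N)%N -> 0 < weight t j.
Proof. by move=> /bt [h _ _ _]; apply: lt_le_trans h; rewrite divr_gt0. Qed.

Let preactE j x : (j < N)%N -> preact t j x = weight t j * (x - q j).
Proof.
by move=> jN; rewrite /preact /q /kink; field; rewrite gt_eqF // weight_gt0.
Qed.

Let d_le j : (j < N)%N -> `|d j| <= 4 * X * T.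
Proof.
move=> jN; have [w1 _ _ _] := bt jN; have w0 := weight_gt0 jN.
have [_ /(_ j jN) [hw hb _]] := tT.
have kX := kapX jN; have X1' := X1; have T0' := T0.
rewrite /= in hw hb.
have h : `|(offset t j - - kap j) + kap j * (weight t j - 1)| <= T + X * T.
  apply: le_trans (ler_normD _ _) _; rewrite lerD // normrM ler_pM //.
have -> : d j = - ((offset t j - - kap j) + kap j * (weight t j - 1)) / weight t j.
  by rewrite /d /q /kink; field; rewrite gt_eqF.
rewrite normrM normrN normfV (gtr0_norm w0) ler_pdivrMr //.
apply: le_trans h _.
have TX : T <= X * T by rewrite ler_peMl.
have : 4 * X * T * (1 / 2) <= 4 * X * T * weight t j.
  by rewrite ler_wpM2l // !mulr_ge0.
by lra.
Qed.

Let d_r j : (j < N)%N -> `|d j| <= r / 2.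
Proof. by move=> /d_le; have := Tr; lra. Qed.

Let q_le j : (j < N)%N -> `|q j| <= 2 * X.
Proof.
move=> jN; have -> : q j = kap j + d j by rewrite /d; ring.
apply: le_trans (ler_normD _ _) _; have := d_r jN; have := kapX jN.
by have := r1; have := X1; lra.
Qed.

(** The interval keeps a margin [r / 2] to all kinks of the target, and those of [t] have moved by
    at most [r / 2]. Hence neurons up to [j] are active in both networks and the later ones are
    inactive in both. *)
Lemma err_affine j x : (j < N)%N -> l j <= x <= l j + r ->
  err t x = (\sum_(0 <= i < j.+1) sig i) * x
    + (bias t - cst - \sum_(0 <= i < j.+1) (sig i * q i + alp i * d i)).
Proof.
move=> jN /andP[x1 x2]; rewrite /err /net /= opprD addrACA -sumrB.
rewrite -(big_mkord xpredT (fun i => outer t i * relu (preact t i x)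
  - alp i * relu (preact target i x))).
rewrite (big_cat_nat _ (n := j.+1)) //=.
rewrite [X in _ + (_ + X)]big_nat_cond [X in _ + (_ + X)]big1 ?addr0; last first.
  move=> i; rewrite andbT => /andP[ji iN].
  have := kap_right ji iN; have := d_r iN; rewrite ler_norml => /andP[h1 h2] h3.
  rewrite preactE // reluM ?ltW ?weight_gt0 //.
  rewrite !relu_neg ?mulr0 ?subrr //.
    by rewrite /preact /=; have := r0; lra.
  by move: h1; rewrite /d; lra.
rewrite [X in _ + X](_ : _ =
   \sum_(0 <= i < j.+1) (sig i * x - (sig i * q i + alp i * d i))).
  by rewrite sumrB -mulr_suml; ring.
apply: eq_big_nat => i /andP[_ ij].
have iN : (i < N)%N by exact: leq_trans ij jN.
have := @kap_left i j ij jN; have := d_r iN; rewrite ler_norml => /andP[h1 h2] h3.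
rewrite preactE // reluM ?ltW ?weight_gt0 //.
rewrite !relu_pos.
- by rewrite /preact /sig /d /=; ring.
- by rewrite /preact /=; have := r0; lra.
- by move: h2; rewrite /d; lra.
Qed.

Let D := 10 * X * ((3 * X / r) * (1 + 32 / (Pm * r))) * S.

Let CS_ge0 : 0 <= ((3 * X / r) * (1 + 32 / (Pm * r))) * S.
Proof.
have Pm0 := ltW (Pm_gt0 hJ); have r0' := ltW r0; have X0 := X_ge0.
by rewrite !mulr_ge0 ?sqrtr_ge0 ?invr_ge0 // addr_ge0 // !mulr_ge0 ?invr_ge0 // mulr_ge0.
Qed.

(** By [affine_coef_bound], slope and intercept of the error on each kink-free interval are at most
    [A]. Passing from one interval to the next changes the slope by [sig j] and the intercept by
    [sig j * q j + alp j * d j], so differences isolate each deviation; on the first interval the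
    slope is [sig 0] itself. The worst case needs [6 * X * A], and the 10 in [D] leaves room. *)
Lemma deviation_bound : `|C0| <= D /\
  forall j, (j < N)%N -> `|sig j| <= D /\ `|beta j| <= D.
Proof.
set A := ((3 * X / r) * (1 + 32 / (Pm * r))) * S.
have A0 : 0 <= A := CS_ge0.
pose m j := \sum_(0 <= i < j.+1) sig i.
pose k j := bias t - cst - \sum_(0 <= i < j.+1) (sig i * q i + alp i * d i).
have mk j : (j < N)%N -> `|m j| <= A /\ `|k j| <= A.
  move=> jN; have ge := good_err hJ N target t.
  have lX : `|l j| <= X.
    by apply: hX; rewrite la //=; have := lb jN; have := r0; lra.
  apply: (affine_coef_bound hJ ge r0 r1 X1 (la jN) (lb jN) lX) => x.
  exact: err_affine.
have X1' := X1.
have AX : A <= X * A by rewrite ler_peMl.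
have DE : D = 10 * (X * A) by rewrite /D /A; ring.
have sigm j : (j < N)%N -> `|sig j| <= 2 * A.
  case: j => [|j] jN.
    have [h _] := mk 0%N jN; move: h; rewrite /m big_nat1 => h.
    by apply: le_trans h _; lra.
  have [h1 _] := mk j (ltnW jN); have [h2 _] := mk j.+1 jN.
  have -> : sig j.+1 = m j.+1 - m j by rewrite /m [in RHS]big_nat_recr //=; ring.
  by apply: le_trans (ler_normB _ _) _; lra.
have sigq j : (j < N)%N -> `|sig j * q j| <= 4 * (X * A).
  move=> jN; have := ler_pM (normr_ge0 _) (normr_ge0 _) (sigm j jN) (q_le jN).
  by rewrite -normrM => h; apply: le_trans h _; lra.
split.
  have [_ h] := mk 0%N N0.
  have -> : C0 = k 0%N + sig 0%N * q 0%N by rewrite /k big_nat1 /C0; ring.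
  apply: le_trans (ler_normD _ _) _; rewrite DE.
  have := sigq 0%N N0; lra.
move=> j jN; split; first by rewrite DE; apply: le_trans (sigm j jN) _; lra.
rewrite /beta; case: j jN => [|j] jN /=.
  by rewrite normr0 DE; lra.
have [_ h1] := mk j (ltnW jN); have [_ h2] := mk j.+1 jN.
have -> : alp j.+1 * d j.+1 = k j - k j.+1 - sig j.+1 * q j.+1.
  by rewrite /k [in RHS](big_nat_recr j.+1) //=; ring.
apply: le_trans (ler_normB _ _) _; have := sigq _ jN.
have := ler_normB (k j) (k j.+1); rewrite DE; lra.
Qed.

(* Moving [t] to [pl_dir] is, to first order, what cancels the error. *)
Definition pl_dir : params R := Params (bias t + C0) (weight t)
  (fun j => offset t j - beta j / outer t j)
  (fun j => outer t j + sig j / weight t j).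

Let outer_neq0 j : (j < N)%N -> alp j != 0 -> m0 <= `|outer t j|.
Proof.
move=> jN aj; have := alp_m0 jN aj; have [_ /(_ j jN) [_ _ h]] := tT.
have := lerB_dist (alp j) (outer t j); rewrite distrC in h.
by rewrite /= in h; have := Tm0; lra.
Qed.

(** The slope errors and the constants cancel exactly. What remains of neuron [j] is the
    displacement of its kink corrected to first order, which [relu_shift] confines to a ball of
    radius [|d j|], with height [|alp j * d j| = |beta j| <= D]. Neuron 0 leaves nothing, its kink
    being outside [[a, b]]. *)
Lemma err_pl_dir x : a <= x <= b ->
  `|err t x - linearization N t pl_dir x|
    <= D * \sum_(j < N) (`|x - kap j| <= 4 * X * T)%R%:R.
Proof.
move=> /andP[ax xb].
pose g j := alp j * (relu (x - q j) - relu (x - kap j)) + beta j * heaviside (x - q j).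
have eqn : err t x - linearization N t pl_dir x = alp 0%N * d 0%N + \sum_(j < N) g j.
  rewrite /err /net /linearization /=.
  have -> : \sum_(j < N) g j = \sum_(j < N) (outer t j * relu (preact t j x))
     - \sum_(j < N) (alp j * relu (preact target j x))
     - \sum_(j < N)
      ((outer t j + sig j / weight t j - outer t j) * relu (preact t j x) +
       ((weight t j - weight t j) * (outer t j * (heaviside (preact t j x) * x)) +
        (offset t j - beta j / outer t j - offset t j) *
        (outer t j * heaviside (preact t j x)))).
    rewrite -!sumrB; apply: eq_bigr => j _; have jN := ltn_ord j.
    have w0 := weight_gt0 jN.
    rewrite preactE // reluM ?ltW // heavisideM // /g.
    have -> : preact target j x = x - kap j by rewrite /preact /= mul1r.
    have -> : (offset t j - beta j / outer t j - offset t j) *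
      (outer t j * heaviside (x - q j)) = - beta j * heaviside (x - q j).
      (* [outer t j] may vanish when the target has no slope jump there, but then [beta j] is 0 and
         no offset has to be moved. *)
      have [b0|bn0] := eqVneq (beta j) 0; first by rewrite b0; ring.
      have aj : alp j != 0.
        by apply: contra_neq bn0; rewrite /beta => ->; rewrite mul0r if_same.
      have oj : outer t j != 0.
        by rewrite -normr_gt0; apply: lt_le_trans (outer_neq0 jN aj).
      by field.
    by rewrite /sig; field; rewrite gt_eqF.
  by rewrite /C0; ring.
rewrite eqn (bigD1 (Ordinal N0)) //= /g.
have -> : alp 0%N * d 0%N + (alp 0%N * (relu (x - q 0%N) - relu (x - kap 0%N))
     + beta 0%N * heaviside (x - q 0%N) + \sum_(i < N | i != Ordinal N0) g i)
  = \sum_(i < N | i != Ordinal N0) g i.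
  have := d_r N0; rewrite ler_norml => /andP[h1 h2].
  rewrite !relu_pos ?/beta ?eqxx; first by rewrite /d; ring.
  - by have := kap0; have := r0; lra.
  - by move: h2; rewrite /d; have := kap0; have := r0; lra.
have D0 : 0 <= D.
  rewrite /D -!mulrA mulr_ge0 // mulr_ge0 //; have := CS_ge0.
  by rewrite -!mulrA.
apply: le_trans (ler_norm_sum _ _ _) _.
rewrite mulr_sumr [leRHS](bigD1 (Ordinal N0)) //=.
apply: le_trans (_ : \sum_(i < N | i != Ordinal N0) D * (`|x - kap i| <= 4 * X * T)%R%:R <= _).
  apply: ler_sum => j j0; have jN := ltn_ord j.
  have [_ /(_ j jN) [_ hb]] := deviation_bound.
  have bE : beta j = alp j * d j.
    by rewrite /beta; case: eqP => // j00; case/eqP: j0; apply/val_inj.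
  have -> : g j = alp j * (relu (x - q j) - relu (x - kap j)
      + (q j - kap j) * heaviside (x - q j)).
    by rewrite /g bE /d; ring.
  rewrite normrM; apply: le_trans (ler_wpM2l (normr_ge0 _) (relu_shift _ _ _)) _.
  rewrite mulrA -normrM -/(d j) -bE ler_pM // ler_nat.
  have [h|h] := boolP (`|x - kap j| <= `|d j|) => //.
  by rewrite (le_trans h (d_le jN)).
by rewrite lerDr mulr_ge0.
Qed.

(** An offset moves by [beta j / outer t j], at most [D / m0] when nonzero; an outer weight moves by
    [sig j / weight t j], at most [2 * D]. *)
Lemma close_pl_dir : params_close N ((2 + m0^-1) * D) t pl_dir.
Proof.
have [hC hj] := deviation_bound.
have D0 : 0 <= D := le_trans (normr_ge0 _) hC.
have mD : 0 <= m0^-1 * D by rewrite mulr_ge0 // invr_ge0 ltW.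
split=> /=.
  by rewrite opprD addNKr normrN; lra.
move=> j jN; have [hs hb] := hj j jN; have [w1 _ _ _] := bt jN.
have w0 := weight_gt0 jN.
split.
- by rewrite subrr normr0; lra.
- rewrite opprD opprK addNKr normrM normfV.
  have [b0|bn0] := eqVneq (beta j) 0; first by rewrite b0 normr0 mul0r; lra.
  have aj : alp j != 0.
    by apply: contra_neq bn0; rewrite /beta => ->; rewrite mul0r if_same.
  have oj := outer_neq0 jN aj.
  have : `|beta j| / `|outer t j| <= D * m0^-1.
    rewrite ler_pM // ?invr_ge0 // lef_pV2 // posrE //.
    exact: lt_le_trans oj.
  by lra.
- rewrite opprD addNKr normrN normrM normfV (gtr0_norm w0) ler_pdivrMr //.
  have : D * (2 * (1 / 2)) <= D * (2 * weight t j) by rewrite ler_wpM2l // ler_wpM2l.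
  have : 0 <= m0^-1 * D * weight t j by rewrite mulr_ge0 // ltW.
  by lra.
Qed.

Hypothesis TPL :
  (10 * X * ((3 * X / r) * (1 + 32 / (Pm * r)))) ^+ 2 * (N%:R ^+ 2 * (PM * (4 * X * T)))
    <= 1 / 2.

(** Let [v] be the linearization towards [pl_dir]. Since [e ^+ 2 - (e - v) ^+ 2 <= 2 * (e * v)] and
    the integral of [(e - v) ^+ 2] is at most half the loss, twice the integral of [e * v] is at
    least half the loss. This quantity is also the gradient paired with a displacement of the order
    of the root of the loss; dividing by that root gives the claim. *)
Lemma loss_lojasiewicz_at : loss t <=
  (2 * (1 + N%:R * 3) * (2 + m0^-1) * (10 * X * ((3 * X / r) * (1 + 32 / (Pm * r))))) ^+ 2
   * sqnorm N (loss_grad t).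
Proof.
set Q := 10 * X * ((3 * X / r) * (1 + 32 / (Pm * r))).
have T0' := T0; have X0 := X_ge0.
have L0 : 0 <= loss t by exact: (loss_ge0 hJ).
have SS : S ^+ 2 = loss t by rewrite sqr_sqrtr.
have DE : D = Q * S by [].
have [hC _] := deviation_bound.
have D0 : 0 <= D := le_trans (normr_ge0 _) hC.
have ge := good_err hJ N target t.
have gl := good_linearization hJ N t pl_dir.
pose ind (j : 'I_N) x : R := (`|x - kap j| <= 4 * X * T)%R%:R.
have gi : good (fun x => \sum_(j < N) ind j x).
  by apply: (good_sum hJ) => j; exact: (good_ball hJ).
have gel := good_mul hJ ge gl.
have ged := good_sqr hJ (good_sub hJ ge gl).
have gs c F : good F -> good (fun x => c * F x).
  by move=> gF; apply: (good_mul hJ) => //; exact: (good_cst hJ).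
have small : J (fun x => (err t x - linearization N t pl_dir x) ^+ 2) <= loss t / 2.
  apply: le_trans (_ : J (fun x => (D ^+ 2 * N%:R) * \sum_(j < N) ind j x) <= _).
    apply: (J_mono hJ) => //; first exact: gs.
    move=> x /err_pl_dir h.
    have s0 : 0 <= \sum_(j < N) ind j x by apply: sumr_ge0.
    have sN : \sum_(j < N) ind j x <= N%:R.
      rewrite -[leRHS]mulr1; apply: sum_le_const => j.
      by rewrite /ind lern1 leq_b1.
    apply: le_trans (_ : (D * \sum_(j < N) ind j x) ^+ 2 <= _).
      by rewrite -real_normK ?num_real // lerXn2r ?nnegrE // mulr_ge0.
    rewrite exprMn -mulrA ler_wpM2l ?sqr_ge0 // expr2 ler_wpM2r //.
  rewrite (J_scale hJ) // (J_sum hJ); last by move=> j; exact: (good_ball hJ).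
  have h : \sum_(j < N) J (ind j) <= N%:R * (PM * (4 * X * T)).
    by apply: sum_le_const => j; apply: (J_ball_le hJ); rewrite !mulr_ge0.
  have DN : 0 <= D ^+ 2 * N%:R by rewrite mulr_ge0 ?sqr_ge0.
  have := ler_wpM2l DN h; have := ler_wpM2l L0 TPL.
  rewrite DE (exprMn _ Q S) SS -/Q => h1 h2.
  apply: le_trans h2 _; lra.
have big : loss t / 2 <= 2 * J (fun x => err t x * linearization N t pl_dir x).
  apply: le_trans (_ : loss t - J (fun x => (err t x - linearization N t pl_dir x) ^+ 2) <= _).
    by lra.
  have ge2 := good_sqr hJ ge.
  rewrite -(J_sub hJ ge2 ged) -(J_scale hJ _ gel).
  apply: (J_mono hJ); [exact: (good_sub hJ)|exact: gs|].
  move=> x _; have := sqr_ge0 (linearization N t pl_dir x); nra.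
have M0 : 0 <= (2 + m0^-1) * D.
  by rewrite mulr_ge0 // addr_ge0 // invr_ge0 ltW.
have := linearization_grad_le hJ target M0 close_pl_dir.
move=> /(le_trans (ler_norm _)) /(le_trans big).
set W := Num.sqrt _ => hh.
have G0 := sqnorm_ge0 N (loss_grad t).
have WW : W ^+ 2 = sqnorm N (loss_grad t) by rewrite sqr_sqrtr.
have W0 : 0 <= W by exact: sqrtr_ge0.
have S0 : 0 <= S by exact: sqrtr_ge0.
rewrite -SS -WW -exprMn.
set Z := 2 * (1 + N%:R * 3) * (2 + m0^-1) * Q.
have hS : S * S <= S * (Z * W).
  by rewrite -expr2 SS; move: hh; rewrite DE /Z; lra.
have [->|Sn0] := eqVneq S 0; first by rewrite expr0n sqr_ge0.
have Spos : 0 < S by rewrite lt_neqAle eq_sym Sn0.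
move: hS; rewrite ler_pM2l // => hS.
by rewrite lerXn2r ?nnegrE // (le_trans S0).
Qed.

End at_params.

Lemma loss_lojasiewicz : exists T C : R, [/\ 0 < T, T <= 1 / 2, 0 < C &
  forall t, params_close N T t target -> loss t <= C * sqnorm N (loss_grad t)].
Proof.
have X1' := X1; have r0' := r0; have m00' := m00; have Pm0 := Pm_gt0 hJ.
have P0 := PM_ge0 hJ; have X0 := X_ge0.
set Q := 10 * X * ((3 * X / r) * (1 + 32 / (Pm * r))).
pose Y := Q ^+ 2 * (N%:R ^+ 2 * (PM * (4 * X))).
have Y0 : 0 <= Y.
  by rewrite /Y mulr_ge0 ?sqr_ge0 // mulr_ge0 ?sqr_ge0 // !mulr_ge0.
pose Y1 := 2 * (Y + 1).
have Y10 : 0 < Y1 by rewrite /Y1; lra.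
have X8 : 0 < 8 * X by lra.
(* In this order: the parameter box, outer weights bounded away from 0 where the target has a jump,
   kinks displaced by at most [r / 2], and an uncancelled part below half the loss. *)
pose T := Num.min (1 / 2) (Num.min m0 (Num.min (r / (8 * X)) Y1^-1)).
have Tpos : 0 < T by rewrite !lt_min divr_gt0 // m00 divr_gt0 // invr_gt0.
exists T, ((2 * (1 + N%:R * 3) * (2 + m0^-1) * Q) ^+ 2 + 1); split => //.
- by rewrite ge_min lexx.
- by rewrite ltr_wpDl // sqr_ge0.
move=> t tT; apply: le_trans (_ : (2 * (1 + N%:R * 3) * (2 + m0^-1) * Q) ^+ 2
   * sqnorm N (loss_grad t) <= _); last first.
  by rewrite ler_wpM2r ?sqnorm_ge0 // lerDl.
apply: (@loss_lojasiewicz_at t T) => //.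
- exact: ltW.
- by rewrite ge_min lexx.
- by rewrite !ge_min lexx orbT.
- by rewrite mulrC -ler_pdivlMr // !ge_min lexx !orbT.
- rewrite -/Q.
  have : Y1 * T <= 1.
    rewrite -(mulfV (lt0r_neq0 Y10)); apply: ler_wpM2l; first exact: ltW.
    by rewrite !ge_min lexx !orbT.
  rewrite /Y1 mulrDr mulrDl => h.
  have -> : Q ^+ 2 * (N%:R ^+ 2 * (PM * (4 * X * T))) = Y * T by rewrite /Y; ring.
  lra.
Qed.

(* The distance travelled so far plus a multiple of the square root of the loss
   does not increase, so the iterates never leave the region where the
   Lojasiewicz inequality holds. *)
Theorem gd_converges : exists g T : R, [/\ 0 < g, 0 < T & forall gamma, 0 < gamma <= g ->
  forall t, params_close N T t target ->
  exists2 rho, 0 <= rho < 1 & forall n,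
    params_close N (1 / 2) (iter n (gd_step gamma) t) target
    /\ loss (iter n (gd_step gamma) t) <= rho ^+ n * loss t].
Proof.
have [T1 [C [T10 T12 C0 PL]]] := loss_lojasiewicz.
have J1 := J1_ge0 hJ; have X0 := X_ge0; have V0 := V_ge0.
pose A := descent_const PM J N X V.
have A0 : 0 <= A by exact: (descent_const_ge0 hJ).
pose B := 2 * ((4 * X * V + 1) * (1 + J (fun=> 1))).
have B0 : 0 <= B by rewrite !mulr_ge0 // addr_ge0 // !mulr_ge0.
pose K := lip_const N X V.
have K1 : 1 <= K by exact: lip_const_ge1.
pose mu := (2 * C)^-1.
have mu0 : 0 < mu by rewrite invr_gt0; lra.
(* A step has length at most [gamma * B] times the root of the loss, and this root drops by at least
   the fraction [gamma * mu / 2]. As [K2 * (gamma * mu / 2) = gamma * B], the drop times [K2] pays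
   for the step. *)
pose K2 := 2 * B / mu.
have K20 : 0 <= K2 by rewrite divr_ge0 ?(ltW mu0) // mulr_ge0.
(* At distance [T] the root of the loss is at most [T * (K * (1 + J (fun=> 1)))], so the whole
   budget [T + K2 * S 0] is at most [T * Z]; this is why the initial radius is [T1 / Z]. *)
pose Z := 1 + K2 * (K * (1 + J (fun=> 1))).
have K0 : 0 <= K by lra.
have J2 : 0 <= 1 + J (fun=> 1) by lra.
have Z1 : 1 <= Z by rewrite /Z lerDl !(mulr_ge0 K20, mulr_ge0 K0).
(* The first bound lets half of the first-order decrease survive the quadratic term; the second
   limits a single step to length [K2 * S n]. *)
pose g := Num.min (2 * (A + 1))^-1 mu^-1.
have A10 : 0 < 2 * (A + 1) by lra.
have g0 : 0 < g by rewrite lt_min (_ : 0 < mu^-1) ?andbT invr_gt0.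
exists g, (T1 / Z); split=> //; first by rewrite divr_gt0 //; lra.
move=> gamma /andP[gam0 gamg] t tT.
have gA : gamma * A <= 1 / 2.
  have h : gamma <= (2 * (A + 1))^-1 by apply: le_trans gamg _; rewrite ge_min lexx.
  have : gamma * (2 * (A + 1)) <= 1.
    by rewrite -ler_pdivlMr ?div1r //; lra.
  by lra.
have gmu : gamma * mu <= 1.
  have h : gamma <= mu^-1 by apply: le_trans gamg _; rewrite ge_min lexx orbT.
  by rewrite -ler_pdivlMr // div1r.
have gmu0 : 0 < gamma * mu by rewrite mulr_gt0.
pose T := T1 / Z.
have TZ : T * Z = T1 by rewrite divfK // gt_eqF //; lra.
have T0 : 0 < T by rewrite divr_gt0 //; lra.
have TT1 : T <= T1 by rewrite -TZ ler_peMr // ltW.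
pose th n := iter n (gd_step gamma) t.
pose S n := Num.sqrt (loss (th n)).
have S0 n : 0 <= S n by exact: sqrtr_ge0.
have SS n : S n ^+ 2 = loss (th n) by rewrite sqr_sqrtr // (loss_ge0 hJ).
have bnd : T + K2 * S 0%N <= T1.
  have : S 0%N <= T * (K * (1 + J (fun=> 1))).
    rewrite -ler_sqr ?nnegrE // ?SS.
      apply: le_trans (loss_le hJ X1 V1 hX weight_ref offset_ref outer_ref _ _ tT) _.
      - exact: ltW.
      - exact: le_trans TT1 T12.
      have -> : (T * (K * (1 + J (fun=> 1)))) ^+ 2 = (K * T) ^+ 2 * (1 + J (fun=> 1)) ^+ 2.
        by ring.
      by apply: ler_wpM2l; rewrite ?sqr_ge0 // expr2; nra.
    by apply: mulr_ge0; [exact: ltW|exact: mulr_ge0].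
  move=> /(ler_wpM2l K20) h; rewrite -TZ /Z; lra.
(* One step multiplies the loss by at most [1 - gamma * mu], which is at most [rho ^+ 2]. *)
pose rho := 1 - gamma * mu / 2.
have rho0 : 0 <= rho by rewrite /rho; lra.
have K2mu : K2 * (gamma * mu / 2) = gamma * B.
  by rewrite /K2; field; rewrite gt_eqF.
have step n : params_close N (T + K2 * (S 0%N - S n)) (th n) target ->
   params_close N (T + K2 * (S 0%N - S n.+1)) (th n.+1) target /\ S n.+1 <= rho * S n.
  move=> cn.
  have Kn : 0 <= K2 * S n by rewrite mulr_ge0.
  have cn1 : params_close N T1 (th n) target by apply: params_close_le cn; lra.
  have cn2 : params_close N (1 / 2) (th n) target by exact: params_close_le cn1.
  have gb := grad_le hJ X1 V1 hX weight_ref offset_ref outer_ref cn2.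
  have st : params_close N (gamma * (B * S n)) (th n) (th n.+1).
    by apply: (gd_step_close (ltW gam0)); exact: gb.
  have mv := params_close_trans (params_close_sym st) cn.
  have gBS : gamma * (B * S n) = (gamma * mu / 2) * (K2 * S n).
    by rewrite mulrA -K2mu; ring.
  (* The descent inequality needs both iterates in the box, so a cruder bound on the step must first
     place the new one there. *)
  have gBle : gamma * (B * S n) <= K2 * S n.
    by rewrite gBS ler_piMl //; lra.
  have cs1 : params_close N T1 (th n.+1) target by apply: params_close_le mv; lra.
  have cs2 : params_close N (1 / 2) (th n.+1) target by exact: params_close_le cs1.
  have de := loss_descent hJ X1 V1 hX weight_ref offset_ref outer_ref (ltW gam0) cn2 cs2.
  have pl := PL _ cn1.
  set Ga := sqnorm N (loss_grad (th n)) in de pl.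
  have Ga0 : 0 <= Ga := sqnorm_ge0 N _.
  have h1 : gamma / 2 * Ga <= (gamma - A * gamma ^+ 2) * Ga.
    rewrite ler_wpM2r //; have := ler_wpM2l (ltW gam0) gA.
    by rewrite expr2; lra.
  have h2 : mu * loss (th n) <= Ga / 2.
    have := ler_wpM2l (ltW mu0) pl.
    have -> : mu * (C * Ga) = Ga / 2 by rewrite /mu; field; rewrite gt_eqF.
    by [].
  have h3 : loss (th n.+1) <= (1 - gamma * mu) * loss (th n).
    have := ler_wpM2l (ltW gam0) h2; rewrite -/A in de.
    have -> : th n.+1 = gd_step gamma (th n) by [].
    by move=> h; move: de h1 h; lra.
  have h4 : S n.+1 <= rho * S n.
    rewrite -ler_sqr ?nnegrE ?mulr_ge0 // exprMn !SS; apply: le_trans h3 _.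
    rewrite ler_wpM2r ?(loss_ge0 hJ) // /rho.
    by have := sqr_ge0 (gamma * mu / 2); rewrite expr2; lra.
  split=> //; apply: params_close_le mv.
  have := ler_wpM2l K20 h4; rewrite /rho gBS; lra.
have all n : params_close N (T + K2 * (S 0%N - S n)) (th n) target /\ S n <= rho ^+ n * S 0%N.
  elim: n => [|n [IH1 IH2]]; first by rewrite subrr mulr0 addr0 expr0 mul1r.
  have [h1 h2] := step n IH1; split => //.
  by apply: le_trans h2 _; rewrite exprS -mulrA ler_wpM2l.
exists (rho ^+ 2).
  rewrite sqr_ge0 /= expr_lt1 //; rewrite /rho; lra.
move=> n; have [h1 h2] := all n; split.
  by have K2S := mulr_ge0 K20 (S0 n); apply: params_close_le h1; lra.
rewrite -exprM mulnC exprM -[loss t](SS 0%N) -[loss _](SS n) -exprMn.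
by rewrite lerXn2r ?nnegrE // mulr_ge0 // exprn_ge0.
Qed.

End lojasiewicz.

(** * Limits of the gradients of the smoothed risks *)

Lemma bounded_integrable_itv (R : realType) (a b M : R) (F : R -> R) :
  measurable_fun `[a, b] F -> (forall x, x \in `[a, b] -> `|F x| <= M) ->
  (@lebesgue_measure R).-integrable `[a, b] (EFin \o F).
Proof.
move=> mF FM; apply: measurable_bounded_integrable => //.
  by rewrite /= lebesgue_measure_itv /=; case: ifP => // _; rewrite -EFinB ltry.
exists M; split; first exact: num_real.
by move=> y My x xab; apply: le_trans (FM x xab) (ltW My).
Qed.

Lemma bounded_Rintegral_cvg (R : realType) (a b M : R) (F_ : nat -> R -> R)
    (F : R -> R) :
  (forall n, measurable_fun `[a, b] (F_ n)) ->
  (forall n x, x \in `[a, b] -> `|F_ n x| <= M) ->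
  (forall x, x \in `[a, b] -> F_ ^~ x @ \oo --> F x) ->
  \int[lebesgue_measure]_(x in `[a, b]) F_ n x @[n --> \oo] -->
  \int[lebesgue_measure]_(x in `[a, b]) F x.
Proof.
move=> mF FM cF; apply: fine_cvg.
have mlim : measurable_fun `[a, b] F.
  by apply: (measurable_fun_cvg mF) => x xab; exact: cF.
have cM : (@lebesgue_measure R).-integrable `[a, b] (EFin \o (fun=> M)).
  by apply: (@bounded_integrable_itv _ _ _ `|M|) => // x _; exact: lexx.
have cEF x : `[a, b]%classic x -> (F_ n x)%:E @[n --> \oo] --> (F x)%:E.
  by move=> xab; apply: cvg_EFin; [exact: nearW|exact: cF].
have := @dominated_convergence _ _ _ (@lebesgue_measure R) `[a, b]%classic
  (measurable_itv _) (fun n x => (F_ n x)%:E) (fun x => (F x)%:E) (EFin \o (fun=> M)).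
case.
- by move=> n; apply/measurable_EFinP; exact: mF.
- exact/measurable_EFinP.
- by apply: aeW => x; exact: cEF.
- exact: cM.
- by apply: aeW => x n xab; rewrite lee_fin; exact: FM.
move=> intF _.
rewrite fineK //; apply: integrable_fin_num => //.
Qed.

Lemma cvg_rV (R : realType) n (u : nat -> 'rV[R]_n) (v : 'rV[R]_n) :
  (forall i, (fun k => u k 0 i) @ \oo --> v 0 i) -> u @ \oo --> v.
Proof.
move=> h; apply/cvgrPdist_lt => e e0.
have near_all : \forall k \near \oo, forall i, `|v 0 i - u k 0 i| < e.
  apply: filter_forall => i.
  exact: (@cvgrPdist_lt _ _ _ _ _ (fun k => u k 0 i) (v 0 i)).1 (h i) e e0.
near=> k.
rewrite /Num.norm /= mx_normrE; apply/bigmax_ltP; split=> // -[i j] _ /=.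
by rewrite !mxE ord1 {i}; move: j; near: k.
Unshelve. all: by end_near. Qed.

(** * Differentiation of the risk under the integral sign *)

Section gradient.
Variables (R : realType) (a b : R) (f p : R -> R) (H : nat).
Implicit Types (theta : 'rV[R]_(3 * H).+1) (s ds : R -> R) (x : R).

Definition neuron_arg theta (j : nat) x : R :=
  theta 0 (inord j) * x + theta 0 (inord (H + j)).

(** The derivative [ds] is an argument of its own, so that one formula covers smooth activations and
    the limiting pair [relu], [heaviside]. The indicators treat all kinds of coordinates at once,
    which keeps differentiation and passage to the limit free of case distinctions. *)
Definition realization_partial s ds theta (i : 'I_(3 * H).+1) x : R :=
  (i == ord_max)%:R + \sum_(j < H)
    ((i == inord (2 * H + j))%:R * s (neuron_arg theta j x)
     + theta 0 (inord (2 * H + j)) * (ds (neuron_arg theta j x)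
         * ((i == inord j)%:R * x + (i == inord (H + j))%:R))).

Definition risk_partial s ds theta (i : 'I_(3 * H).+1) x : R :=
  2 * (realization s theta x - f x) * realization_partial s ds theta i x * p x.

Lemma is_derive_realization s ds theta (i : 'I_(3 * H).+1) x (h : R) :
  (forall y : R, is_derive y 1 s (ds y)) ->
  is_derive h 1 (fun h => realization s (h *: delta_mx 0 i + theta) x)
    (realization_partial s ds (h *: delta_mx 0 i + theta) i x).
Proof.
move=> ds_s.
have dc (k : 'I_(3 * H).+1) : is_derive h 1
    (fun h => (h *: delta_mx 0 i + theta) 0 k : R) (i == k)%:R.
  have -> : (fun h => (h *: delta_mx 0 i + theta) 0 k) =
      (i == k)%:R \*: (@id R) + cst (theta 0 k).
    by apply/funext => t; rewrite !mxE !fctE eqxx /= eq_sym mulrC.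
  by apply: is_derive_eq; rewrite addr0 [_ *: _]mulr1.
have dn (j : nat) : is_derive h 1 (fun h => neuron_arg (h *: delta_mx 0 i + theta) j x)
    ((i == inord j)%:R * x + (i == inord (H + j))%:R).
  have -> : (fun h => neuron_arg (h *: delta_mx 0 i + theta) j x) =
    (fun h => (h *: delta_mx 0 i + theta) 0 (inord j)) * cst x
    + (fun h => (h *: delta_mx 0 i + theta) 0 (inord (H + j))) by [].
  apply: is_derive_eq.
  by rewrite scaler0 add0r [cst x h *: _]mulrC.
rewrite /realization /realization_partial.
have -> : (fun h => (h *: delta_mx 0 i + theta) 0 ord_max +
    \sum_(j < H) (h *: delta_mx 0 i + theta) 0 (inord (2 * H + j)) *
      s ((h *: delta_mx 0 i + theta) 0 (inord j) * x +
         (h *: delta_mx 0 i + theta) 0 (inord (H + j)))) =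
   (fun h => (h *: delta_mx 0 i + theta) 0 ord_max) + \sum_(j < H)
     ((fun h => (h *: delta_mx 0 i + theta) 0 (inord (2 * H + j))) *
      (fun h => s (neuron_arg (h *: delta_mx 0 i + theta) j x))).
  by apply/funext => t; rewrite !fctE fct_sumE.
apply: is_deriveD; apply: is_derive_sum => j.
have dcomp : is_derive h 1 (fun h => s (neuron_arg (h *: delta_mx 0 i + theta) j x))
    (ds (neuron_arg (h *: delta_mx 0 i + theta) j x) *
      ((i == inord j)%:R * x + (i == inord (H + j))%:R)).
  exact: (@is_derive1_comp R s
    (fun h => neuron_arg (h *: delta_mx 0 i + theta) j x) h _ _ (ds_s _) (dn j)).
apply: is_derive_eq.
by rewrite addrC /= [_ *: (i == _)%:R]mulrC.
Qed.

Hypothesis mf : measurable_fun `[a, b] f.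
Hypothesis mp : measurable_fun `[a, b] p.

Lemma measurable_realization s theta : measurable_fun setT s ->
  measurable_fun `[a, b] (realization s theta).
Proof.
move=> ms; apply: measurable_funD => //; apply: measurable_sum => j.
apply: measurable_funM => //; apply: measurableT_comp => //.
by apply: measurable_funD => //; apply: measurable_funM.
Qed.

Lemma measurable_realization_partial s ds theta i :
  measurable_fun setT s -> measurable_fun setT ds ->
  measurable_fun `[a, b] (realization_partial s ds theta i).
Proof.
have mn j : measurable_fun `[a, b] (neuron_arg theta j).
  by apply: measurable_funD => //; apply: measurable_funM.
move=> ms mds; apply: measurable_funD => //; apply: measurable_sum => j.
apply: measurable_funD; apply: measurable_funM => //; first exact: measurableT_comp.
apply: measurable_funM; first exact: measurableT_comp.
by apply: measurable_funD => //; apply: measurable_funM.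
Qed.

Lemma measurable_risk_partial s ds theta i :
  measurable_fun setT s -> measurable_fun setT ds ->
  measurable_fun `[a, b] (risk_partial s ds theta i).
Proof.
move=> ms mds; apply: measurable_funM => //; apply: measurable_funM.
  apply: measurable_funM => //; apply: measurable_funB => //.
  exact: measurable_realization.
exact: measurable_realization_partial.
Qed.

Section bounds.
Variables (X B M F Q : R).
Hypothesis hX : forall x, x \in `[a, b] -> `|x| <= X.
Hypothesis hF : forall x, x \in `[a, b] -> `|f x| <= F.
Hypothesis hQ : forall x, x \in `[a, b] -> `|p x| <= Q.

Definition act_bounded s ds := forall y, `|y| <= B * (X + 1) -> `|s y| <= M /\ `|ds y| <= M.

Definition risk_bound : R := (F + (B + H%:R * (B * M))) ^+ 2 * Q.
Definition risk_partial_bound : R :=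
  2 * ((B + H%:R * (B * M)) + F) * (1 + H%:R * (M + B * (M * (X + 1)))) * Q.

Lemma neuron_arg_bound theta j x : (forall k, `|theta 0 k| <= B) ->
  x \in `[a, b] -> `|neuron_arg theta j x| <= B * (X + 1).
Proof.
move=> tB /hX xX; apply: le_trans (ler_normD _ _) _.
by rewrite mulrDr mulr1 normrM lerD // ler_pM.
Qed.

Lemma realization_bound s ds theta x : act_bounded s ds ->
  (forall k, `|theta 0 k| <= B) ->
  x \in `[a, b] -> `|realization s theta x| <= B + H%:R * (B * M).
Proof.
move=> hs tB xab; apply: le_trans (ler_normD _ _) _; rewrite lerD //.
apply: le_trans (ler_norm_sum _ _ _) _.
rewrite mulr_natl -[H in leRHS]card_ord -sumr_const; apply: ler_sum => j _.
by rewrite normrM ler_pM // (hs _ (neuron_arg_bound j tB xab)).1.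
Qed.

Lemma realization_partial_bound s ds theta i x : act_bounded s ds ->
  (forall k, `|theta 0 k| <= B) -> x \in `[a, b] ->
  `|realization_partial s ds theta i x| <= 1 + H%:R * (M + B * (M * (X + 1))).
Proof.
have indic := @normr_bool_le1 R.
move=> hs tB xab; apply: le_trans (ler_normD _ _) _; rewrite lerD //.
apply: le_trans (ler_norm_sum _ _ _) _.
rewrite mulr_natl -[H in leRHS]card_ord -sumr_const; apply: ler_sum => j _.
have [h1 h2] := hs _ (neuron_arg_bound j tB xab).
apply: le_trans (ler_normD _ _) _; rewrite !normrM lerD //.
  by rewrite -[leRHS]mul1r ler_pM.
rewrite ler_pM ?mulr_ge0 // ler_pM //; apply: le_trans (ler_normD _ _) _.
rewrite lerD // normrM -[leRHS]mul1r ler_pM //; exact: hX.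
Qed.

Lemma risk_integrand_bound s ds theta x : act_bounded s ds ->
  (forall k, `|theta 0 k| <= B) -> x \in `[a, b] ->
  `|(f x - realization s theta x) ^+ 2 * p x| <= risk_bound.
Proof.
move=> hs tB xab; rewrite normrM normrX ler_pM ?exprn_ge0 //; last exact: hQ.
have h : `|f x - realization s theta x| <= F + (B + H%:R * (B * M)).
  apply: le_trans (ler_normB _ _) _; rewrite lerD ?hF //.
  exact: realization_bound hs tB xab.
by rewrite lerXn2r ?nnegrE // (le_trans _ h).
Qed.

Lemma risk_partial_le s ds theta i x : act_bounded s ds ->
  (forall k, `|theta 0 k| <= B) -> x \in `[a, b] ->
  `|risk_partial s ds theta i x| <= risk_partial_bound.
Proof.
move=> hs tB xab; rewrite /risk_partial !normrM.
have h1 : `|realization s theta x - f x| <= (B + H%:R * (B * M)) + F.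
  apply: le_trans (ler_normB _ _) _; rewrite lerD ?hF //.
  exact: realization_bound hs tB xab.
have h2 := realization_partial_bound i hs tB xab.
rewrite ler_pM ?mulr_ge0 ?hQ // ler_pM ?mulr_ge0 // ler_pM // ger0_norm //.
Qed.

(** The coordinate is varied by [h] in []-1, 1[]. Starting from entries at most [B - 1] keeps all
    perturbed entries below [B], where [risk_partial_bound] is a dominating constant. *)
Lemma risk_gradient_coord s ds theta i :
  (forall y : R, is_derive y 1 s (ds y)) -> continuous ds -> act_bounded s ds ->
  (forall k, `|theta 0 k| <= B - 1) ->
  gradient (@risk R a b f p s H) theta 0 i =
  \int[lebesgue_measure]_(x in `[a, b]) risk_partial s ds theta i x.
Proof.
move=> ds_s cds hs tB; rewrite mxE.
have cs : continuous s.
  by move=> y; apply/differentiable_continuous/derivable1_diffP; case: (ds_s y).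
have ms : measurable_fun setT s by exact: continuous_measurable_fun.
have mds : measurable_fun setT ds by exact: continuous_measurable_fun.
pose th (h : R) := h *: delta_mx 0 i + theta.
have thB h : h \in `]-1, 1[ -> forall k, `|th h 0 k| <= B.
  move=> hI k; rewrite !mxE; apply: le_trans (ler_normD _ _) _.
  have -> : B = 1 + (B - 1) by ring.
  rewrite lerD // normrM -[leRHS]mulr1 ler_pM //.
    by move: hI; rewrite in_itv /= => /andP[h1 h2]; rewrite ler_norml !ltW.
  by case: (_ && _); rewrite ?normr1 ?normr0.
pose F1 (h x : R) := (f x - realization s (th h) x) ^+ 2 * p x.
have dF1 (h x : R) : is_derive h 1 (F1 ^~ x) (risk_partial s ds (th h) i x).
  have dr := is_derive_realization theta i x h ds_s.
  have -> : F1 ^~ x = (cst (f x) - (fun h => realization s (th h) x)) ^+ 2 * cst (p x).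
    by apply/funext => t; rewrite /F1 !fctE.
  apply: is_derive_eq.
  rewrite /= expr1 /risk_partial !fctE /cst scaler0 add0r sub0r.
  rewrite ![_ *: _]mulrC /th /=.
  set u := realization s _ x; set v := realization_partial _ _ _ _ _.
  by ring.
have := @cvg_differentiation_under_integral R _ _ (@lebesgue_measure R) F1 `[a, b]%classic
  (measurable_itv _) 0 (-1) 1.
have I0 : `](-1 : R), 1[%classic 0 by rewrite /= in_itv /= ltrN10 ltr01.
move=> /(_ I0); have intF1 h : `]-1, 1[%classic h ->
    (@lebesgue_measure R).-integrable `[a, b] (EFin \o F1 h).
  move=> hI; apply: (@bounded_integrable_itv _ _ _ risk_bound).
    apply: measurable_funM => //; apply: measurable_funX; apply: measurable_funB => //.
    exact: measurable_realization.
  by move=> x xab; apply: (risk_integrand_bound hs (thB h hI)).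
move=> /(_ intF1); have der x y : `]-1, 1[%classic x -> `[a, b]%classic y ->
   derivable (F1 ^~ y) x 1.
  by move=> _ _; case: (dF1 x y).
have partE (h x : R) : partial1of2 F1 h x = risk_partial s ds (th h) i x.
  by rewrite partial1of2E; apply: derive_val; exact: dF1.
move=> /(_ der (fun=> `|risk_partial_bound|)) /(_ (fun=> normr_ge0 _)).
have intG : (@lebesgue_measure R).-integrable `[a, b] (EFin \o (fun=> `|risk_partial_bound|)).
  by apply: (@bounded_integrable_itv _ _ _ `|risk_partial_bound|) => // x _; rewrite normr_id.
move=> /(_ intG); have G_ub x y : `]-1, 1[%classic x -> `[a, b]%classic y ->
    `|partial1of2 F1 x y| <= `|risk_partial_bound|.
  move=> xI yab; rewrite partE; apply: le_trans (ler_norm _).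
  by apply: (risk_partial_le _ hs (thB x xI)).
move=> /(_ G_ub) lim.
rewrite /derive.
have -> : (fun h => h^-1 *: ((@risk R a b f p s H \o shift theta) (h *: delta_mx 0 i)
    - @risk R a b f p s H theta)) =
  (fun h => h^-1 *: ((\int[lebesgue_measure]_(y in `[a, b]) F1 (h + 0) y)
     - (\int[lebesgue_measure]_(y in `[a, b]) F1 0 y))).
  by apply/funext => h; rewrite /= addr0 /F1 /th scale0r add0r /risk.
rewrite (cvg_lim _ lim) //; apply: eq_Rintegral => x _.
by rewrite partE /th scale0r add0r.
Qed.

End bounds.
End gradient.

Lemma cvg_sum (R : realType) (I : Type) (s : seq I) (u : I -> nat -> R) (l : I -> R) :
  (forall i, u i n @[n --> \oo] --> l i) ->
  \sum_(i <- s) u i n @[n --> \oo] --> \sum_(i <- s) l i.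
Proof. by move=> ul; apply: cvg_big => //; exact: add_continuous. Qed.

(** * Passage to the limit in the activation *)

Section activation_limit.
Variables (R : realType) (act : nat -> R -> R).
Hypothesis act_C1 : forall r : nat, (0 < r)%N -> continuously_differentiable (act r).
Hypothesis act_bounded_derive : forall x : R,
     (ereal_sup [set ereal_sup [set (`|derive1 (act r) y|)%:E
                                | y in `[(- `|x|)%R, `|x|%R]]
                 | r in [set r : nat | (0 < r)%N]] < +oo)%E.
Hypothesis act_limsup : forall x : R,
     limn_esup (fun r : nat =>
       (`|act r x - relu x|
        + `|derive1 (act r) x - \1_(`]0, +oo[%classic : set R) x|)%:E) = 0%E.

Lemma act_is_derive r (y : R) : (0 < r)%N -> is_derive y 1 (act r) (derive1 (act r) y).
Proof. by move=> /act_C1[h _]; rewrite derive1E; apply/derivableP. Qed.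

Lemma limn_esup_eq0_cvg (u : nat -> R) : (forall n, 0 <= u n) ->
  limn_esup (fun n => (u n)%:E) = 0%E -> u @ \oo --> 0.
Proof.
move=> u0 h; have : (u n)%:E @[n --> \oo] --> 0%:E.
  by apply: limn_esup_le_cvg => [|n]; [rewrite h|rewrite lee_fin].
by move=> /fine_cvgP[].
Qed.

Lemma act_cvg (x : R) : act r x @[r --> \oo] --> relu x /\
  derive1 (act r) x @[r --> \oo] --> heaviside x.
Proof.
have h0 := limn_esup_eq0_cvg _ (act_limsup x).
have {}h0 := h0 (fun n => addr_ge0 (normr_ge0 _) (normr_ge0 _)).
have hE : \1_(`]0, +oo[%classic : set R) x = heaviside x.
  by rewrite indicE /heaviside mem_setE in_itv /= andbT.
rewrite hE in h0.
have sq (v : nat -> R) (l : R) : (forall n, `|v n - l| <= `|act n x - relu x|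
    + `|derive1 (act n) x - heaviside x|) -> v @ \oo --> l.
  move=> vl; apply/subr_cvg0; apply: norm_cvg0.
  apply: (@squeeze_cvgr _ _ _ _ (cst 0) _ _ _ _ _ h0); last exact: cvg_cst.
  by apply: nearW => n; rewrite normr_ge0 vl.
by split; apply: sq => n; rewrite ?lerDl ?lerDr.
Qed.

Lemma derive_act_bound (Z : R) : exists M, 0 <= M /\
  forall r y, (0 < r)%N -> `|y| <= Z -> `|derive1 (act r) y| <= M.
Proof.
have := act_bounded_derive Z; set s := ereal_sup _ => sfin.
have le r y : (0 < r)%N -> `|y| <= Z -> ((`|derive1 (act r) y|)%:E <= s)%E.
  move=> r0 yZ; apply: le_trans (_ : (ereal_sup [set (`|derive1 (act r) y|)%:E
     | y in `[(- `|Z|)%R, `|Z|%R]] <= _)%E); last first.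
    by apply: ereal_sup_ubound; exists r.
  apply: ereal_sup_ubound; exists y => //=.
  by rewrite in_itv /= -ler_norml (le_trans yZ) // ler_norm.
case: s sfin le => [M _ le| // |_ le].
- exists `|M|; split => // r y r0 yZ; have := le r y r0 yZ.
  by rewrite lee_fin => /le_trans; apply; exact: ler_norm.
- exists 0; split => // r y r0 yZ; have := le r y r0 yZ.
  by rewrite leeNy_eq.
Qed.

(** Only the derivatives are assumed to be bounded uniformly in [r]. For the values, the convergent
    sequence [act r 0] is bounded, and the mean value theorem extends this to [|y| <= Z]. *)
Lemma act_bound (Z : R) : 0 <= Z -> exists M, 0 <= M /\
  forall r y, (0 < r)%N -> `|y| <= Z -> `|act r y| <= M /\ `|derive1 (act r) y| <= M.
Proof.
move=> Z0; have [M [M0 hM]] := derive_act_bound Z.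
have [c0 _] := act_cvg 0.
have [M1 [_ hM1]] := cvg_seq_bounded (cvgP _ c0).
have {}hM1 r : `|act r 0| <= `|M1| + 1.
  by apply: hM1 => //; rewrite ltr_pwDr // ler_norm.
exists (`|M1| + 1 + M * Z + M); split; first by rewrite !addr_ge0 // mulr_ge0.
move=> r y r0 yZ; split; last first.
  by apply: le_trans (hM r y r0 yZ) _; rewrite lerDr !addr_ge0 // mulr_ge0.
have ca : continuous (act r).
  move=> u; apply/differentiable_continuous/derivable1_diffP.
  by case: (act_is_derive u r0).
have mvt (u v : R) : u <= v -> `|u| <= Z -> `|v| <= Z ->
    `|act r v - act r u| <= M * (v - u).
  move=> uv uZ vZ.
  have [|c cuv ->] := @MVT_segment _ (act r) (derive1 (act r)) u v uv
    (fun w _ => act_is_derive w r0).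
    exact: continuous_subspaceT.
  rewrite normrM [X in _ * X]ger0_norm ?subr_ge0 // ler_wpM2r ?subr_ge0 //.
  apply: hM => //; move: cuv; rewrite in_itv /= => /andP[uc cv].
  move: uZ vZ; rewrite !ler_norml => /andP[? ?] /andP[? ?].
  by apply/andP; split; lra.
have h : `|act r y - act r 0| <= M * Z.
  case: (lerP 0 y) => y0.
    apply: le_trans (mvt 0 y y0 _ yZ) _; first by rewrite normr0.
    by rewrite subr0 ler_wpM2l // (le_trans _ yZ) // ler_norm.
  rewrite distrC; apply: le_trans (mvt y 0 (ltW y0) yZ _) _; first by rewrite normr0.
  by rewrite sub0r ler_wpM2l // (le_trans _ yZ) // -normrN ler_norm.
have -> : act r y = act r 0 + (act r y - act r 0) by ring.
apply: le_trans (ler_normD _ _) _.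
by apply: le_trans (lerD (hM1 r) h) _; rewrite lerDl.
Qed.

Variables (a b : R) (f p : R -> R) (F Q : R).
Hypothesis mf : measurable_fun `[a, b] f.
Hypothesis mp : measurable_fun `[a, b] p.
Hypothesis hF : forall x, x \in `[a, b] -> `|f x| <= F.
Hypothesis hQ : forall x, x \in `[a, b] -> `|p x| <= Q.

Lemma risk_gradient_cvg (H : nat) (theta : 'rV[R]_(3 * H).+1) :
  gradient (@risk R a b f p (act r) H) theta @[r --> \oo] -->
  \row_i \int[lebesgue_measure]_(x in `[a, b])
     risk_partial f p (@relu R) (@heaviside R) theta i x.
Proof.
pose B := \sum_k `|theta 0 k| + 1; pose X := Num.max `|a| `|b|.
have X0 : 0 <= X by rewrite le_max normr_ge0.
have B0 : 0 <= B by rewrite addr_ge0 // sumr_ge0.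
have tB k : `|theta 0 k| <= B - 1.
  by rewrite /B addrK (bigD1 k) //= lerDl sumr_ge0.
have tB' k : `|theta 0 k| <= B by apply: le_trans (tB k) _; rewrite gerBl.
have hX x : x \in `[a, b] -> `|x| <= X.
  rewrite in_itv /= /X le_max => /andP[ax xb]; case: (ger0P x) => x0; apply/orP.
    by right; apply: le_trans xb (ler_norm b).
  by left; rewrite -normrN; apply: le_trans (ler_norm _); rewrite lerN2.
have [M [M0 hM]] := @act_bound (B * (X + 1)) (mulr_ge0 B0 (addr_ge0 X0 ler01)).
have hs r : act_bounded X B M (act r.+1) (derive1 (act r.+1)).
  by move=> y; exact: hM.
have cact r : continuous (act r.+1).
  move=> u; apply/differentiable_continuous/derivable1_diffP.
  by case: (act_is_derive u (ltn0Sn r)).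
have cdact r : continuous (derive1 (act r.+1)) by have [] := act_C1 (ltn0Sn r).
(* Nothing is known about [act 0], so the sequence is shifted by one. *)
rewrite -cvg_shiftS; apply: cvg_rV => i.
rewrite [X in X @ \oo --> _](_ : _ = fun r =>
  \int[lebesgue_measure]_(x in `[a, b])
     risk_partial f p (act r.+1) (derive1 (act r.+1)) theta i x); last first.
  apply/funext => r.
  apply: (risk_gradient_coord mf mp hX hF hQ) => //.
  by move=> y; exact: act_is_derive.
rewrite mxE.
apply: (@bounded_Rintegral_cvg _ _ _ (risk_partial_bound H X B M F Q)).
- by move=> r; apply: measurable_risk_partial => //; exact: continuous_measurable_fun.
- move=> r x xab.
  exact: (risk_partial_le hX hF hQ i (hs r)).
move=> x xab.
have c1 y : act r.+1 y @[r --> \oo] --> relu y.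
  by rewrite (cvg_shiftS (fun r => act r y)); have [] := act_cvg y.
have c2 y : derive1 (act r.+1) y @[r --> \oo] --> heaviside y.
  by rewrite (cvg_shiftS (fun r => derive1 (act r) y)); have [] := act_cvg y.
have cr : realization (act r.+1) theta x @[r --> \oo] --> realization (@relu R) theta x.
  apply: cvgD; first exact: cvg_cst.
  by apply: cvg_sum => j; apply: cvgM => //; exact: cvg_cst.
have cp : realization_partial (act r.+1) (derive1 (act r.+1)) theta i x @[r --> \oo]
    --> realization_partial (@relu R) (@heaviside R) theta i x.
  apply: cvgD; first exact: cvg_cst.
  apply: cvg_sum => j; apply: cvgD; apply: cvgM => //; try exact: cvg_cst.
  by apply: cvgM => //; exact: cvg_cst.
apply: cvgM; last exact: cvg_cst.
apply: cvgM => //; apply: cvgM; first exact: cvg_cst.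
by apply: cvgB => //; exact: cvg_cst.
Qed.

End activation_limit.

(** * The weighted Lebesgue integral *)

Lemma lipschitz_continuous_itv (R : realType) (a b : R) (p : R -> R) :
  [lipschitz p x | x in `[a, b]] -> {within `[a, b], continuous p}.
Proof.
move=> [M0 [_ lip]]; pose M := `|M0| + 1.
have {}lip x y : x \in `[a, b] -> y \in `[a, b] -> `|p x - p y| <= M * `|x - y|.
  move=> xab yab; have := lip M _ (x, y); apply => //=.
  by rewrite /M ltr_pwDr // ler_norm.
have Mpos : 0 < M by rewrite ltr_wpDl.
apply/subspace_continuousP => x xab.
apply/cvgrPdist_lt => e e0; rewrite near_withinE; near=> y => yab.
apply: le_lt_trans (lip x y xab yab) _.
rewrite mulrC -ltr_pdivlMr //; near: y.
apply: (@cvgr_dist_lt _ _ _ (nbhs x) _ id x) => //.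
by rewrite divr_gt0.
Unshelve. all: by end_near. Qed.

Lemma continuous_itv_bounded (R : realType) (a b : R) (f : R -> R) :
  {within `[a, b], continuous f} -> exists M, forall x, x \in `[a, b] -> `|f x| <= M.
Proof.
move=> cf; have := continuous_compact cf (@segment_compact R a b).
move=> /compact_bounded [M [_ hM]]; exists (M + 1) => x xab.
by apply: hM; [rewrite ltrDl|exists x].
Qed.

Section weighted.
Variables (R : realType) (a b : R) (p : R -> R) (Pl Ph : R).
Hypothesis ab : a < b.
Hypothesis cp : {within `[a, b], continuous p}.
Hypothesis Pl0 : 0 < Pl.
Hypothesis hPl : forall x, x \in `[a, b] -> Pl <= p x.
Hypothesis hPh : forall x, x \in `[a, b] -> p x <= Ph.
Implicit Types F G : R -> R.

Local Notation mu := (@lebesgue_measure R).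

Definition bounded_measurable F : Prop := measurable_fun `[a, b] F /\
  exists M, forall x, x \in `[a, b] -> `|F x| <= M.

Definition wint F : R := \int[mu]_(x in `[a, b]) (F x * p x).

Let mp : measurable_fun `[a, b] p.
Proof. by apply: subspace_continuous_measurable_fun. Qed.

Let p_norm x : x \in `[a, b] -> `|p x| <= Ph.
Proof. by move=> xab; rewrite ger0_norm ?hPh // (le_trans _ (hPl xab)) ?ltW. Qed.

Let integrable_wint F : bounded_measurable F ->
  mu.-integrable `[a, b] (EFin \o (fun x => F x * p x)).
Proof.
move=> [mF [M hM]]; apply: (@bounded_integrable_itv _ _ _ (M * Ph)).
  exact: measurable_funM.
by move=> x xab; rewrite normrM ler_pM ?hM ?p_norm.
Qed.

Lemma continuous_relu : continuous (@relu R).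
Proof.
move=> x; apply/cvgrPdist_lt => e e0; near=> y.
apply: le_lt_trans (relu_lip _ _) _; near: y.
exact: (@cvgr_dist_lt _ _ _ (nbhs x) _ id x).
Unshelve. all: by end_near. Qed.

Lemma measurable_heaviside : measurable_fun setT (@heaviside R).
Proof.
have -> : @heaviside R = \1_(`]0, +oo[%classic).
  by apply/funext => x; rewrite indicE /heaviside mem_setE in_itv /= andbT.
exact: measurable_indic.
Qed.

Lemma ball_indicE (q t : R) :
  (fun x => (`|x - q| <= t)%R%:R) = \1_(`[q - t, q + t]%classic) :> (R -> R).
Proof. by apply/funext => x; rewrite indicE mem_setE in_itv /= ler_distl. Qed.

Lemma Rintegral_ball (q t : R) :
  \int[mu]_(x in `[a, b]) (`|x - q| <= t)%R%:R = fine (mu (`[q - t, q + t] `&` `[a, b])).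
Proof.
transitivity (Rintegral mu `[a, b]%classic (\1_(`[q - t, q + t]%classic) : R -> R)).
  by rewrite -ball_indicE.
by rewrite /Rintegral integral_indic.
Qed.

(** A ball of radius [t] has length [2 * t], which explains the factors 2 in front of the bounds of
    [p]; intersecting with [[a, b]] can only decrease it, and leaves it intact when the ball lies
    inside. *)
Lemma weighted_integral_lebesgue :
  weighted_integral a b (2 * Pl) (2 * Ph) bounded_measurable wint.
Proof.
have gball (q t : R) : bounded_measurable (fun x => (`|x - q| <= t)%R%:R).
  split; first by rewrite ball_indicE.
  by exists 1 => x _; exact: normr_bool_le1.
have iball (q t : R) : mu.-integrable `[a, b] (EFin \o (fun x => (`|x - q| <= t)%R%:R)).
  by have [m1 [M m2]] := gball q t; exact: (bounded_integrable_itv m1 m2).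
have Ph0 : 0 <= Ph.
  have aab : a \in `[a, b] by rewrite in_itv /= lexx (ltW ab).
  exact: le_trans (normr_ge0 _) (p_norm aab).
split.
- by rewrite mulr_gt0.
- by rewrite mulr_ge0.
- by move=> c; split => //; exists `|c|.
- split=> //; have cid : {within `[a, b], continuous (@id R)}.
    by apply: continuous_subspaceT => x; exact: cvg_id.
  have [M hM] := continuous_itv_bounded cid.
  by exists M.
- move=> F G [mF [M hM]] [mG [M' hM']]; split; first exact: measurable_funD.
  by exists (M + M') => x xab; rewrite (le_trans (ler_normD _ _)) // lerD ?hM ?hM'.
- move=> F G [mF [M hM]] [mG [M' hM']]; split; first exact: measurable_funM.
  by exists (M * M') => x xab; rewrite normrM ler_pM ?hM ?hM'.
- move=> F [mF [M hM]]; split.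
    by apply: measurableT_comp => //; apply: continuous_measurable_fun; exact: continuous_relu.
  by exists M => x xab; apply: le_trans (relu_norm _) (hM x xab).
- move=> F [mF [M hM]]; split.
    by apply: measurableT_comp => //; exact: measurable_heaviside.
  by exists 1 => x _; exact: heaviside_norm.
- exact: gball.
- move=> F G gF gG; rewrite /wint -RintegralD //; try exact: integrable_wint.
  by apply: eq_Rintegral => x _; rewrite mulrDl.
- move=> c F gF; rewrite /wint -RintegralZl //; last exact: integrable_wint.
  by apply: eq_Rintegral => x _; rewrite mulrA.
- move=> F G gF gG FG; apply: le_Rintegral => //; try exact: integrable_wint.
  move=> x xab; rewrite ler_wpM2r //; last by apply: FG; move: xab; rewrite /= in_itv.
  by apply: le_trans (hPl xab); exact: ltW.
- move=> q t t0; rewrite /wint.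
  apply: (@le_trans _ _ (\int[mu]_(x in `[a, b]) (Ph * (`|x - q| <= t)%R%:R))).
    apply: le_Rintegral => //; first exact: integrable_wint.
      apply: (@bounded_integrable_itv _ _ _ (Ph * 1)).
        by have [m1 _] := gball q t; exact: measurable_funM.
      by move=> x _; rewrite normrM ler_pM ?normr_bool_le1 // ger0_norm.
    by move=> x xab; rewrite mulrC ler_wpM2r ?hPh.
  rewrite RintegralZl // Rintegral_ball.
  have -> : 2 * Ph * t = Ph * (2 * t) by ring.
  rewrite ler_wpM2l // -lee_fin fineK; last first.
    rewrite ge0_fin_numE //; apply: le_lt_trans (_ : (mu (`[a, b]) < +oo)%E).
      by apply: le_measure; rewrite ?inE //; exact: measurableI.
    by rewrite lebesgue_measure_itv /=; case: ifP => // _; rewrite -EFinB ltry.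
  apply: (@le_trans _ _ (mu (`[q - t, q + t]%classic))).
    by apply: le_measure; rewrite ?inE //; exact: measurableI.
  rewrite lebesgue_measure_itv /=; case: ifP => _; last by rewrite lee_fin mulr_ge0.
  by rewrite -EFinB lee_fin; lra.
- move=> q t t0 aq qb; rewrite /wint.
  apply: (@le_trans _ _ (\int[mu]_(x in `[a, b]) (Pl * (`|x - q| <= t)%R%:R))); last first.
    apply: le_Rintegral => //; last by move=> x xab; rewrite mulrC ler_wpM2l ?hPl.
      apply: (@bounded_integrable_itv _ _ _ (Pl * 1)).
        by have [m1 _] := gball q t; exact: measurable_funM.
      by move=> x _; rewrite normrM ler_pM ?normr_bool_le1 // gtr0_norm.
    exact: integrable_wint.
  rewrite RintegralZl // Rintegral_ball setIidl; last first.
    by apply: subset_itv; rewrite bnd_simp.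
  have -> : 2 * Pl * t = Pl * (2 * t) by ring.
  apply: ler_wpM2l; first exact: ltW.
  rewrite lebesgue_measure_itv /= lte_fin.
  case: (ltP (q - t) (q + t)) => h; last by rewrite /=; lra.
  by rewrite -EFinB /=; lra.
Qed.

End weighted.

(** * Piecewise affine functions as networks *)

(** Provides the smallest gap between knots and the smallest nonzero slope jump; the premise
    [0 < u j] lets vanishing jumps pass. *)
Lemma nat_pos_lower_bound (R : realFieldType) (n : nat) (u : nat -> R) :
  exists2 m, 0 < m & forall j, (j < n)%N -> 0 < u j -> m <= u j.
Proof.
elim: n => [|n [m m0 IH]]; first by exists 1.
have [un|un] := ltP 0 (u n); last first.
  exists m => // j; rewrite ltnS leq_eqVlt => /orP[/eqP ->|]; last exact: IH.
  by rewrite ltNge un.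
exists (Num.min m (u n)); first by rewrite lt_min m0.
move=> j; rewrite ltnS leq_eqVlt => /orP[/eqP -> _|jn uj].
  by rewrite ge_min lexx orbT.
by rewrite ge_min IH.
Qed.

Section piecewise_affine.
Variables (R : realType) (N : nat) (knot : nat -> R) (a b : R) (f : R -> R).
Hypothesis N0 : (0 < N)%N.
Hypothesis knot0 : knot 0%N = a.
Hypothesis knot_lt : forall i : nat, (i < N)%N -> knot i < knot i.+1.
Hypothesis knotN : knot N = b.
Hypothesis f_affine : forall i : nat, (i < N)%N -> affine_on `[knot i, knot i.+1] f.

Definition slope (i : nat) : R := (f (knot i.+1) - f (knot i)) / (knot i.+1 - knot i).

(* The first kink lies outside [a, b], so that its neuron is affine there. *)
Definition kink_pos (i : nat) : R := if i is j.+1 then knot j.+1 else a - 1.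

Definition slope_jump (i : nat) : R :=
  if i is j.+1 then slope j.+1 - slope j else slope 0.

Lemma knot_le i j : (i <= j)%N -> (j <= N)%N -> knot i <= knot j.
Proof.
elim: j => [|j IH]; first by rewrite leqn0 => /eqP ->.
rewrite leq_eqVlt => /orP[/eqP -> //|ij jN].
by apply: le_trans (IH ij (ltnW jN)) (ltW (knot_lt jN)).
Qed.

Lemma slopeE i x : (i < N)%N -> knot i <= x <= knot i.+1 ->
  f x = f (knot i) + slope i * (x - knot i).
Proof.
move=> iN xi; have k := knot_lt iN; have [c [d fE]] := f_affine iN.
rewrite /slope (fE x) ?(fE (knot i)) ?(fE (knot i.+1)) /= ?in_itv //= ?lexx ?ltW //.
by field; rewrite subr_eq0 gt_eqF.
Qed.

(** The second clause carries the induction: past its last kink the partial sum continues with the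
    slope of the last piece, so the next neuron only has to add the slope jump. The constant
    [f a - slope 0] offsets the value 1 that the first neuron, with kink [a - 1], has at [a]. *)
Lemma piecewise_affine_partial m : (m < N)%N ->
  (forall x, a <= x <= knot m.+1 -> f x = f a - slope 0 +
     \sum_(j < m.+1) slope_jump j * relu (x - kink_pos j)) /\
  (forall x, knot m <= x -> f a - slope 0 +
     \sum_(j < m.+1) slope_jump j * relu (x - kink_pos j) =
     f (knot m) + slope m * (x - knot m)).
Proof.
elim: m => [|m IH] mN.
  have E x : a <= x -> f a - slope 0 +
     \sum_(j < 1) slope_jump j * relu (x - kink_pos j) = f a + slope 0 * (x - a).
    by move=> ax; rewrite big_ord1 /= relu_pos; [ring|lra].
  split=> x; last by rewrite knot0; exact: E.
  move=> /andP[ax xk]; rewrite E // -knot0; apply: slopeE => //.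
  by rewrite knot0 ax.
have [IH1 IH2] := IH (ltnW mN).
have E x : knot m.+1 <= x -> f a - slope 0 +
     \sum_(j < m.+2) slope_jump j * relu (x - kink_pos j) =
     f (knot m.+1) + slope m.+1 * (x - knot m.+1).
  move=> kx; have km := knot_lt (ltnW mN).
  rewrite big_ord_recr /= addrA IH2 ?(le_trans (ltW km)) //.
  have kk : knot m <= knot m.+1 <= knot m.+1 by rewrite lexx (ltW km).
  by rewrite relu_pos ?subr_ge0 // (slopeE (ltnW mN) kk); ring.
split=> // x /andP[ax xk]; have [kx|kx] := lerP (knot m.+1) x.
  by rewrite E // (@slopeE m.+1 x mN) // kx.
rewrite big_ord_recr /= addrA -IH1 ?ax ?ltW // relu_neg ?mulr0 ?addr0 //.
by rewrite subr_le0 ltW.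
Qed.

Lemma piecewise_affine_net x : a <= x <= b ->
  f x = net N (target (f a - slope 0) kink_pos slope_jump) x.
Proof.
have NE : N = N.-1.+1 by rewrite prednK.
have [h _] := @piecewise_affine_partial N.-1 (ltac:(by rewrite -NE)).
rewrite -{1}knotN {1}NE => /h ->; rewrite /net /= -NE; congr (_ + _).
by apply: eq_bigr => j _; rewrite /preact /= mul1r.
Qed.

End piecewise_affine.

Section gd_piecewise_affine.
Variables (R : realType) (N : nat) (knot : nat -> R) (a b : R) (f : R -> R).
Hypothesis N0 : (0 < N)%N.
Hypothesis knot0 : knot 0%N = a.
Hypothesis knot_lt : forall i : nat, (i < N)%N -> knot i < knot i.+1.
Hypothesis knotN : knot N = b.
Variables (Pm PM : R) (good : (R -> R) -> Prop) (J : (R -> R) -> R).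
Hypothesis hJ : weighted_integral a b Pm PM good J.

Lemma gd_converges_knots (cst : R) (alp : nat -> R)
    (ref := target cst (kink_pos knot a) alp) :
  exists g T : R, [/\ 0 < g, 0 < T & forall gamma, 0 < gamma <= g ->
  forall t, params_close N T t ref ->
  exists2 rho, 0 <= rho < 1 & forall n,
    params_close N (1 / 2) (iter n (gd_step J N ref gamma) t) ref
    /\ loss J N ref (iter n (gd_step J N ref gamma) t) <= rho ^+ n * loss J N ref t].
Proof.
have kle := knot_le knot_lt.
have [r1 r10 hr1] := nat_pos_lower_bound N (fun j => knot j.+1 - knot j).
(* At most half the smallest gap, so that an interval of length [r] with margins [r / 2] fits
   between consecutive knots; at most 1, so that the kink [a - 1] stays at distance [r] from
   [[a, b]]. *)
pose r := Num.min 1 (r1 / 2).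
have r0 : 0 < r by rewrite lt_min ltr01 divr_gt0.
have r1' : r <= 1 by rewrite ge_min lexx.
have gap j : (j < N)%N -> knot j + 2 * r <= knot j.+1.
  move=> jN; have k := knot_lt jN; have := hr1 j jN; rewrite subr_gt0 => /(_ k) h.
  have : r <= r1 / 2 by rewrite ge_min lexx orbT.
  lra.
have [m1 m10 hm1] := nat_pos_lower_bound N (fun j => `|alp j|).
pose X := `|a| + `|b| + 1; pose V := 1 + \sum_(j < N) `|alp j|.
pose l (j : nat) := if j is i.+1 then knot i.+1 + r / 2 else a.
have ka j : (j <= N)%N -> a <= knot j by rewrite -knot0 => jN; exact: kle.
have kb j : (j <= N)%N -> knot j <= b by rewrite -knotN => jN; exact: kle.
have a0 := normr_ge0 a; have b0 := normr_ge0 b.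
have aa := ler_norm (- a); have bb := ler_norm b; rewrite normrN in aa.
apply: (@gd_converges R a b Pm PM good J hJ N X V r (m1 / 2) cst _ alp l N0).
- by rewrite /X; lra.
- by rewrite /V lerDl sumr_ge0.
- exact: r0.
- exact: r1'.
- by rewrite divr_gt0.
- move=> x /andP[ax xb]; rewrite /X ler_norml; apply/andP; split; lra.
- move=> [|j] jN /=; rewrite /X ler_norml; apply/andP.
    have := ler_norm a; have := kb 0%N (ltnW jN); rewrite knot0; split; lra.
  by have := ka j.+1 (ltnW jN); have := kb j.+1 (ltnW jN); split; lra.
- move=> j jN; rewrite /V (bigD1 (Ordinal jN)) //= addrCA lerDl addr_ge0 // sumr_ge0 //.
- move=> j jN aj; have : m1 <= `|alp j| by apply: hm1 => //; rewrite normr_gt0.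
  by lra.
- by rewrite /=; lra.
- move=> [|j] jN //=; have := ka j.+1 (ltnW jN); lra.
- move=> [|j] jN /=.
    by have := gap 0%N jN; have := kb 1%N jN; rewrite knot0; lra.
  by have := gap j.+1 jN; have := kb j.+2 jN; lra.
- move=> [|i] [|j] ij jN //=.
  + by lra.
  + by have := ka j.+1 (ltnW jN); lra.
  + by have := kle i.+1 j.+1 ij (ltnW jN); lra.
- move=> [|i] j ji iN //=.
  have h1 := kle j.+1 i.+1 ji (ltnW iN); have h2 := gap j (leq_trans ji (ltnW iN)).
  by case: j ji h1 h2 => [|j] ji /=; rewrite ?knot0; lra.
Qed.

End gd_piecewise_affine.

(** * Gradient descent in the parameter space *)

Lemma eq_inord (n i j : nat) : (i <= n)%N -> (j <= n)%N ->
  (inord i == inord j :> 'I_n.+1) = (i == j).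
Proof. by move=> iN jN; rewrite -val_eqE /= !inordK. Qed.

Lemma ord_max_inord n : ord_max = inord n :> 'I_n.+1.
Proof. by apply/val_inj; rewrite /= inordK. Qed.

Lemma sum_nat_delta (R : pzRingType) (n k : nat) (F : nat -> R) : (k < n)%N ->
  \sum_(j < n) (k == j)%:R * F j = F k.
Proof.
move=> kn; rewrite (bigD1 (Ordinal kn)) //= eqxx mul1r big1 ?addr0 // => j.
rewrite -val_eqE /= eq_sym => /negbTE ->; exact: mul0r.
Qed.

Section parameter_vector.
Variables (R : realType) (a b : R) (f p : R -> R) (N : nat) (ref : params R).
Variables (Pm PM : R).
Hypothesis hJ : weighted_integral a b Pm PM (bounded_measurable a b) (wint a b p).
Hypothesis f_net : forall x, a <= x <= b -> f x = net N ref x.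
Variable H : nat.
Hypothesis NH : (N <= H)%N.
Implicit Types theta : 'rV[R]_(3 * H).+1.

Let J := wint a b p.
Local Notation lgrad := (loss_grad J N ref).

(** The value 0 beyond [H] allows [params_of_step] to be an equality of records on all of [nat], and
    makes these neurons idle. *)
Definition params_of theta : params R := Params (theta 0 ord_max)
  (fun j => if (j < H)%N then theta 0 (inord j) else 0)
  (fun j => if (j < H)%N then theta 0 (inord (H + j)) else 0)
  (fun j => if (j < H)%N then theta 0 (inord (2 * H + j)) else 0).

Definition relu_gradient theta : 'rV[R]_(3 * H).+1 :=
  \row_i \int[lebesgue_measure]_(x in `[a, b])
     risk_partial f p (@relu R) (@heaviside R) theta i x.

(** A preactivation equal to 0 is allowed because [heaviside 0 = 0]: such a neuron still has zero
    gradient. *)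
Definition idle (t : params R) : Prop :=
  forall j x, (N <= j)%N -> a <= x <= b -> preact t j x <= 0.

Lemma J_eq F G : bounded_measurable a b F -> bounded_measurable a b G ->
  (forall x, a <= x <= b -> F x = G x) -> J F = J G.
Proof.
move=> gF gG FG; apply/eqP; rewrite eq_le !(J_mono hJ) // => x /FG ->//.
Qed.

Lemma J_eq0 F : bounded_measurable a b F ->
  (forall x, a <= x <= b -> F x = 0) -> J F = 0.
Proof.
move=> gF F0; rewrite (J_eq gF (good_cst hJ 0)) //.
by rewrite /J (J_cst hJ) mul0r.
Qed.

Lemma realization_net theta x : realization (@relu R) theta x = net H (params_of theta) x.
Proof.
rewrite /realization /net; congr (_ + _); apply: eq_bigr => j _.
by rewrite /preact /= ltn_ord.
Qed.

Lemma net_idle t x : idle t -> a <= x <= b -> net H t x = net N t x.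
Proof.
move=> it xab; rewrite /net; congr (_ + _).
rewrite -!(big_mkord xpredT (fun j => outer t j * relu (preact t j x))).
rewrite (big_cat_nat _ (n := N)) //= [X in _ + X]big_nat_cond [X in _ + X]big1 ?addr0 //.
by move=> j; rewrite andbT => /andP[Nj _]; rewrite relu_neg ?mulr0 ?it.
Qed.

Lemma realization_err theta x : idle (params_of theta) -> a <= x <= b ->
  realization (@relu R) theta x - f x = err N ref (params_of theta) x.
Proof. by move=> it xab; rewrite realization_net net_idle // f_net. Qed.

Lemma risk_loss theta : idle (params_of theta) ->
  risk a b f p (@relu R) theta = loss J N ref (params_of theta).
Proof.
move=> it; rewrite /risk /loss /J /wint; apply: eq_Rintegral => x.
rewrite inE /= in_itv /= => xab; rewrite -realization_err //.
by rewrite -sqrrN opprB.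
Qed.

Lemma relu_gradient_coord theta i (F : R -> R) : idle (params_of theta) ->
  bounded_measurable a b F ->
  (forall x, realization_partial (@relu R) (@heaviside R) theta i x = F x) ->
  relu_gradient theta 0 i = 2 * J (fun x => err N ref (params_of theta) x * F x).
Proof.
move=> it gF FE; rewrite -(J_scale hJ); last first.
  by apply: (good_mul hJ) => //; exact: (good_err hJ).
rewrite mxE; apply: eq_Rintegral => x; rewrite inE /= in_itv /= => xab.
by rewrite /risk_partial realization_err // FE !mulrA.
Qed.

Lemma realization_partial_bias theta x :
  realization_partial (@relu R) (@heaviside R) theta ord_max x = 1.
Proof.
rewrite /realization_partial eqxx big1 ?addr0 // => j _.
rewrite ord_max_inord.
have jH := ltn_ord j.
rewrite !eq_inord; try lia.
have -> : (3 * H == 2 * H + j)%N = false by lia.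
have -> : (3 * H == j)%N = false by lia.
have -> : (3 * H == H + j)%N = false by lia.
by rewrite /= !mulr0n !mul0r addr0 !mulr0 addr0.
Qed.

Lemma realization_partial_weight theta k x (t := params_of theta) : (k < H)%N ->
  realization_partial (@relu R) (@heaviside R) theta (inord k) x =
    outer t k * (heaviside (preact t k x) * x).
Proof.
move=> kH; rewrite /realization_partial.
rewrite ord_max_inord eq_inord; try lia.
have -> : (k == 3 * H)%N = false by lia.
rewrite /= mulr0n add0r
  -(sum_nat_delta (fun j => outer t j * (heaviside (preact t j x) * x)) kH).
apply: eq_bigr => j _; have jH := ltn_ord j.
rewrite !eq_inord; try lia.
have -> : (k == 2 * H + j)%N = false by lia.
have -> : (k == H + j)%N = false by lia.
by rewrite /= !mulr0n mul0r add0r addr0 /t /preact /= jH /neuron_arg; ring.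
Qed.

Lemma realization_partial_offset theta k x (t := params_of theta) : (k < H)%N ->
  realization_partial (@relu R) (@heaviside R) theta (inord (H + k)) x =
    outer t k * heaviside (preact t k x).
Proof.
move=> kH; rewrite /realization_partial.
rewrite ord_max_inord eq_inord; try lia.
have -> : (H + k == 3 * H)%N = false by lia.
rewrite /= mulr0n add0r -(sum_nat_delta (fun j => outer t j * heaviside (preact t j x)) kH).
apply: eq_bigr => j _; have jH := ltn_ord j.
rewrite !eq_inord; try lia.
have -> : (H + k == 2 * H + j)%N = false by lia.
have -> : (H + k == j)%N = false by lia.
rewrite eqn_add2l.
by rewrite /= !mulr0n !mul0r !add0r /t /preact /= jH /neuron_arg; ring.
Qed.

Lemma realization_partial_outer theta k x (t := params_of theta) : (k < H)%N ->
  realization_partial (@relu R) (@heaviside R) theta (inord (2 * H + k)) x =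
    relu (preact t k x).
Proof.
move=> kH; rewrite /realization_partial.
rewrite ord_max_inord eq_inord; try lia.
have -> : (2 * H + k == 3 * H)%N = false by lia.
rewrite /= mulr0n add0r -(sum_nat_delta (fun j => relu (preact t j x)) kH).
apply: eq_bigr => j _; have jH := ltn_ord j.
rewrite !eq_inord; try lia.
have -> : (2 * H + k == H + j)%N = false by lia.
have -> : (2 * H + k == j)%N = false by lia.
rewrite eqn_add2l.
by rewrite /= !mulr0n !mul0r addr0 !mulr0 addr0 /t /preact /= jH.
Qed.

(** Idle neurons do not contribute to the error, so the gradient at width [H] pairs every partial
    derivative with the error at width [N]. For indices beyond [H] the zero entries make all
    components of the step vanish. *)
Lemma params_of_step gamma theta : idle (params_of theta) ->
  params_of (theta - gamma *: relu_gradient theta) =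
  gd_step J N ref gamma (params_of theta).
Proof.
move=> it; set t := params_of theta.
have gG i F gF FE := @relu_gradient_coord theta i F it gF FE.
have ge := good_err hJ N ref t.
have stepE i : (theta - gamma *: relu_gradient theta) 0 i =
    theta 0 i - gamma * relu_gradient theta 0 i.
  by move: (relu_gradient theta) => g; rewrite !mxE.
rewrite /gd_step {1}/params_of stepE; congr Params.
- rewrite (gG _ _ (good_cst hJ 1) (realization_partial_bias theta)) /=.
  by congr (_ - _ * (2 * J _)); apply/funext => x; rewrite mulr1.
- apply/funext => j /=; have [jH|jH] := ltnP j H; last first.
    rewrite J_eq0 ?mulr0 ?subr0 //; last by move=> x _; rewrite !(mul0r, mulr0).
    apply: (good_mul hJ) => //; apply: (good_mul hJ); first exact: (good_cst hJ).
    apply: (good_mul hJ); last exact: (good_id hJ).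
    by apply: (good_heaviside hJ); exact: (good_preact hJ).
  by rewrite stepE (gG _ _ (good_weight_partial hJ t j)
    (fun x => realization_partial_weight theta x jH)) /= jH.
- apply/funext => j /=; have [jH|jH] := ltnP j H; last first.
    rewrite J_eq0 ?mulr0 ?subr0 //; last by move=> x _; rewrite !(mul0r, mulr0).
    by apply: (good_mul hJ) => //; apply: (good_mul hJ); [exact: (good_cst hJ)|
      apply: (good_heaviside hJ); exact: (good_preact hJ)].
  by rewrite stepE (gG _ _ (good_offset_partial hJ t j)
    (fun x => realization_partial_offset theta x jH)) /= jH.
- apply/funext => j /=; have [jH|jH] := ltnP j H; last first.
    rewrite J_eq0 ?mulr0 ?subr0 //.
      by apply: (good_mul hJ) => //; apply: (good_relu hJ); exact: (good_preact hJ).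
    move=> x _; rewrite relu_neg ?mulr0 //.
    by rewrite /preact /t /= ltnNge jH /= mul0r addr0.
  by rewrite stepE (gG _ _ (good_outer_partial hJ t j)
    (fun x => realization_partial_outer theta x jH)).
Qed.

(** Idleness depends only on inner weight and offset, and [heaviside] vanishes in both of their
    partial derivatives. *)
Lemma idle_gd_step gamma t : idle t -> idle (gd_step J N ref gamma t).
Proof.
move=> it j x Nj xab; rewrite /preact /gd_step /=.
have h y : a <= y <= b -> heaviside (preact t j y) = 0.
  by move=> yab; rewrite heaviside_neg ?it.
have ge := good_err hJ N ref t.
have -> : J (fun y => err N ref t y * (outer t j * (heaviside (preact t j y) * y))) = 0.
  apply: J_eq0 => [|y /h ->]; last by rewrite !(mul0r, mulr0).
  exact: (good_mul hJ ge (good_weight_partial hJ t j)).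
have -> : J (fun y => err N ref t y * (outer t j * heaviside (preact t j y))) = 0.
  apply: J_eq0 => [|y /h ->]; last by rewrite !(mul0r, mulr0).
  exact: (good_mul hJ ge (good_offset_partial hJ t j)).
by rewrite !mulr0 !subr0 it.
Qed.

Lemma params_of_iter gamma (theta : nat -> 'rV[R]_(3 * H).+1) :
  idle (params_of (theta 0%N)) ->
  (forall n, theta n.+1 = theta n - gamma *: relu_gradient (theta n)) ->
  forall n, idle (params_of (theta n)) /\
   params_of (theta n) = iter n (gd_step J N ref gamma) (params_of (theta 0%N)).
Proof.
move=> i0 step; elim=> [//|n [IH1 IH2]].
by rewrite step params_of_step // iterS -IH2; split=> //; exact: idle_gd_step.
Qed.

(* Neurons [j >= N] are centred at weight 0 and offset -1, where they vanish on
   [a, b]. *)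
Definition centre : 'rV[R]_(3 * H).+1 := \row_(k < (3 * H).+1)
  if (k < H)%N then (k < N)%N%:R
  else if (k < 2 * H)%N then (if (k - H < N)%N then offset ref (k - H) else - 1)
  else if (k < 3 * H)%N then (if (k - 2 * H < N)%N then outer ref (k - 2 * H) else 0)
  else bias ref.

(** The bound [T] on [delta] gives closeness of the first [N] neurons. For the others the
    preactivation is at most [delta * X + delta - 1], which is nonpositive as soon as
    [delta <= (X + 1)^-1]. *)
Lemma centre_nbhs (X T : R) : 0 < T -> 0 <= X -> (forall x, a <= x <= b -> `|x| <= X) ->
  (forall j, (j < N)%N -> weight ref j = 1) ->
  exists2 delta, 0 < delta & forall theta,
    (forall k, `|theta 0 k - centre 0 k| < delta) ->
    idle (params_of theta) /\ params_close N T (params_of theta) ref.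
Proof.
move=> T0 X0 hX wref; have X10 : 0 < X + 1 by lra.
exists (Num.min T (X + 1)^-1); first by rewrite lt_min T0 invr_gt0.
move=> theta h.
have hT k : `|theta 0 k - centre 0 k| <= T.
  by apply/ltW/(lt_le_trans (h k)); rewrite ge_min lexx.
have hX1 k : `|theta 0 k - centre 0 k| <= (X + 1)^-1.
  by apply/ltW/(lt_le_trans (h k)); rewrite ge_min lexx orbT.
have cw j : (j < H)%N -> centre 0 (inord j) = (j < N)%N%:R.
  by move=> jH; rewrite mxE inordK ?jH //; lia.
have co j : (j < H)%N -> centre 0 (inord (H + j)) = if (j < N)%N then offset ref j else - 1.
  move=> jH; rewrite mxE inordK; last by lia.
  have -> : (H + j < H)%N = false by lia.
  have -> : (H + j < 2 * H)%N by lia.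
  by rewrite addKn.
have cv j : (j < H)%N -> centre 0 (inord (2 * H + j)) = if (j < N)%N then outer ref j else 0.
  move=> jH; rewrite mxE inordK; last by lia.
  have -> : (2 * H + j < H)%N = false by lia.
  have -> : (2 * H + j < 2 * H)%N = false by lia.
  have -> : (2 * H + j < 3 * H)%N by lia.
  by rewrite addKn.
split; last first.
  split=> /=.
    have := hT ord_max; rewrite mxE /=.
    have -> : (3 * H < H)%N = false by lia.
    have -> : (3 * H < 2 * H)%N = false by lia.
    by rewrite ltnn.
  move=> j jN; have jH := leq_trans jN NH; rewrite jH.
  have := hT (inord j); have := hT (inord (H + j)); have := hT (inord (2 * H + j)).
  by rewrite (cw j jH) (co j jH) (cv j jH) jN wref.
move=> j x Nj /hX xX; rewrite /preact /=.
have [jH|jH] := ltnP j H; last by rewrite mul0r addr0.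
have := hX1 (inord (H + j)); have := hX1 (inord j).
rewrite (cw j jH) (co j jH) ltnNge Nj /= subr0 opprK => h1 h2.
set w := theta 0 _ in h1 *; set o := theta 0 _ in h2 *.
have : w * x <= (X + 1)^-1 * X.
  by apply: le_trans (ler_norm _) _; rewrite normrM ler_pM.
have : o + 1 <= (X + 1)^-1 by apply: le_trans (ler_norm _) h2.
have : (X + 1)^-1 * X + (X + 1)^-1 = 1 by rewrite -{2}[(X + 1)^-1]mulr1 -mulrDr mulVf ?gt_eqF.
lra.
Qed.

End parameter_vector.

Lemma gd_risk_cvg (R : realType) (N : nat) (knot : nat -> R) (a b : R) (f p : R -> R) :
  (0 < N)%N -> a < b -> knot 0%N = a ->
  (forall i : nat, (i < N)%N -> knot i < knot i.+1) -> knot N = b ->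
  (forall i : nat, (i < N)%N -> affine_on `[knot i, knot i.+1] f) ->
  (forall x, x \in `[a, b] -> 0 < p x) -> {within `[a, b], continuous p} ->
  exists2 g : R, 0 < g & forall gamma, 0 < gamma <= g -> forall H, (N <= H)%N ->
  exists (c : 'rV[R]_(3 * H).+1) (delta : R), 0 < delta /\
  forall theta : nat -> 'rV[R]_(3 * H).+1,
    (forall k, `|theta 0%N 0 k - c 0 k| < delta) ->
    (forall n, theta n.+1 = theta n - gamma *: relu_gradient a b f p (theta n)) ->
    risk a b f p (@relu R) (theta n) @[n --> \oo] --> 0.
Proof.
move=> N0 ab knot0 knot_lt knotN f_affine p0 cp.
have [xl xlab hl] := EVT_min (ltW ab) cp.
have [xh xhab hh] := EVT_max (ltW ab) cp.
have hJ := weighted_integral_lebesgue ab cp (p0 _ xlab) hl hh.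
set ref := target (f a - slope knot f 0) (kink_pos knot a) (slope_jump knot f).
have f_net : forall x, a <= x <= b -> f x = net N ref x.
  by move=> x; exact: piecewise_affine_net.
have [g [T [g0 T0 conv]]] := gd_converges_knots N0 knot0 knot_lt knotN hJ
  (f a - slope knot f 0) (slope_jump knot f).
exists g => // gamma gammag H NH.
have hX x : a <= x <= b -> `|x| <= `|a| + `|b|.
  move=> /andP[ax xb]; have := ler_norm (- a); have := ler_norm b.
  have := normr_ge0 a; have := normr_ge0 b.
  by rewrite normrN ler_norml => *; apply/andP; split; lra.
have X0 : 0 <= `|a| + `|b| by rewrite addr_ge0.
have [//|delta delta0 hdelta] := @centre_nbhs R a b N ref H NH _ _ T0 X0 hX.
exists (centre N ref H), delta; split => // theta /hdelta[it ct] step.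
have iter_step := params_of_iter hJ f_net NH it step.
have [rho /andP[rho0 rho1] hrho] := conv gamma gammag _ ct.
apply: (@squeeze_cvgr _ _ _ _ (cst 0) (fun n => rho ^+ n *
    loss (wint a b p) N ref (params_of (theta 0%N)))).
- apply: nearW => n; have [itn eqn] := iter_step n.
  rewrite (risk_loss p f_net NH itn) (loss_ge0 hJ) /= eqn.
  by have [_] := hrho n.
- exact: cvg_cst.
- rewrite -[X in _ --> X](mul0r (loss (wint a b p) N ref (params_of (theta 0%N)))).
  by apply: cvgM; [apply: cvg_expr; rewrite ger0_norm|exact: cvg_cst].
Qed.

(** * Random initialization *)

Lemma measurable_coord (R : realType) (n : nat) (i : 'I_n) :
  measurable_fun [set: borel_rV R n] (fun v : borel_rV R n => (v : 'rV[R]_n) 0 i : R).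
Proof.
apply: (measurability _ (RGenOpens.measurableE R)).
move=> _ [_ [l [r ->]] <-]; rewrite setTI; apply: sub_sigma_algebra.
apply: (open_comp (f := fun v : 'rV[R]_n => v 0 i)); last exact: interval_open.
by move=> v _; exact: coord_continuous.
Qed.

(** On a bounded interval the density is bounded below by a positive constant. *)
Lemma normal_prob_itv_gt0 (R : realType) (l r : R) : l < r ->
  (0 < normal_prob 0 1 `]l, r[%classic)%E.
Proof.
move=> lr; pose B := `|l| + `|r|.
pose c := normal_peak 1 * expR (- (B ^+ 2)) : R.
have c0 : 0 < c by rewrite mulr_gt0 ?expR_gt0 // normal_peak_gt0 // oner_neq0.
apply: (@lt_le_trans _ _ (\int[lebesgue_measure]_(x in `]l, r[) (c%:E))%E).
  rewrite integral_cst //= lebesgue_measure_itv /= lte_fin lr -EFinB -EFinM lte_fin.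
  by rewrite mulr_gt0 // subr_gt0.
rewrite /normal_prob; apply: ge0_le_integral => //.
- by move=> x _; rewrite lee_fin ltW.
- by apply/measurable_EFinP/measurable_funTS; exact: measurable_normal_pdf.
move=> x; rewrite /= in_itv /= => /andP[lx xr].
rewrite lee_fin normal_pdfE ?oner_neq0 // ler_wpM2l ?normal_peak_ge0 // ler_expR.
rewrite subr0 expr1n mulNr lerN2.
have xB : `|x| <= B.
  have := ler_norm (- l); have := ler_norm r; have := normr_ge0 l; have := normr_ge0 r.
  by rewrite normrN ler_norml /B => *; apply/andP; split; lra.
have : x ^+ 2 <= B ^+ 2.
  by rewrite -real_normK ?num_real // lerXn2r ?nnegrE // (le_trans _ xB).
by have := sqr_ge0 x; lra.
Qed.

Lemma prode_fin_gt0 (R : realType) (I : Type) (s : seq I) (q : I -> \bar R) :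
  (forall i, 0 < q i)%E -> (forall i, q i <= 1)%E ->
  exists2 r : R, 0 < r & (\prod_(i <- s) q i)%E = r%:E.
Proof.
move=> q0 q1; elim: s => [|i s [r r0 IH]]; first by exists 1; rewrite ?big_nil.
rewrite big_cons IH; have := q0 i; have := q1 i; case: (q i) => [t t1 t0| |] //.
by exists (t * r); rewrite ?EFinM // mulr_gt0.
Qed.

(** In the sup norm a ball is a product of intervals, so independence of the coordinates gives a
    product of positive numbers. The number [q] is fixed before the probability space and the
    vector, hence is the same for all initializations. *)
Lemma standard_normal_ball (R : realType) (n : nat) (c : 'rV[R]_n) (delta : R) :
  0 < delta -> exists2 q : R, 0 < q &
  forall (d : measure_display) (T : measurableType d) (P : probability T R)
    (X : T -> 'rV[R]_n), standard_normal_vector P X ->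
    P [set w | forall i, `|X w 0 i - c 0 i| < delta] = q%:E.
Proof.
move=> delta0.
pose A (i : 'I_n) : set (measurableTypeR R) := `]c 0 i - delta, c 0 i + delta[%classic.
pose J := [fset i in enum 'I_n]%fset.
have lr (i : 'I_n) : c 0 i - delta < c 0 i + delta by rewrite ltrD2l gtrN.
have [q q0 Eq] := @prode_fin_gt0 R _ J (fun i => normal_prob 0 1 (A i))
  (fun i => normal_prob_itv_gt0 (lr i))
  (fun i => probability_le1 (normal_prob 0 1) (measurable_itv _)).
exists q => // d T P X [indep normal].
rewrite -Eq; have := indep J A (fun _ _ => I) (fun i _ => measurable_itv _).
have -> : [set w | forall i, `|X w 0 i - c 0 i| < delta] =
    \bigcap_(i in [set` J]) (fun w => X w 0 i : measurableTypeR R) @^-1` A i.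
  apply/seteqP; split=> w /= h i.
    by move=> _; rewrite /A /= in_itv /= -ltr_distl.
  have iJ : i \in J by rewrite !inE mem_enum.
  by have := h i iJ; rewrite /A /= in_itv /= -ltr_distl.
move=> ->; apply: eq_bigr => i _; apply: (normal i (A i)); exact: measurable_itv.
Qed.

Lemma independent_hits (R : realType) (d : measure_display) (T : measurableType d)
    (P : probability T R) (d' : measure_display) (U : measurableType d')
    (X : nat -> T -> U) (A : set U) (q : R) (K : nat) :
  independent P [set k : nat | (0 < k)%N] X -> measurable A ->
  (forall k, (0 < k)%N -> measurable_fun [set: T] (X k)) ->
  (forall k, (0 < k)%N -> P (X k @^-1` A) = q%:E) ->
  P (\bigcup_(k in [set k | (1 <= k <= K)%N]) X k @^-1` A) = (1 - (1 - q) ^+ K)%:E.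
Proof.
move=> indep mA mX PA.
have mXA B k : measurable B -> (0 < k)%N -> measurable (X k @^-1` B).
  by move=> mB k0; rewrite -[X in measurable X]setTI; exact: mX.
pose J := [fset k in iota 1 K]%fset.
have JE k : (k \in J) = (1 <= k <= K)%N by rewrite !inE mem_iota add1n ltnS.
have := indep J (fun=> ~` A).
have -> : (\bigcup_(k in [set k | (1 <= k <= K)%N]) X k @^-1` A) =
    ~` (\bigcap_(k in [set` J]) X k @^-1` (~` A)).
  rewrite setC_bigcap; apply/seteqP; split=> w [k /= kK h]; exists k => //=.
  - by rewrite JE.
  - by rewrite -JE.
  - exact: contrapT.
have mI : measurable (\bigcap_(k in [set` J]) X k @^-1` (~` A)).
  apply: bigcap_measurableType => k /=; rewrite JE => /andP[k0 _].
  by apply: mXA => //; exact: measurableC.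
have J0 : [set` J] `<=` [set k : nat | (0 < k)%N] by move=> k /=; rewrite JE => /andP[].
move=> /(_ J0 (fun _ _ => measurableC mA)) h; rewrite probability_setC // [X in (1 - X)%E]h.
rewrite big_seq (eq_bigr (fun=> (1 - q)%:E)); last first.
  move=> k; rewrite JE => /andP[k0 _].
  by rewrite preimage_setC probability_setC ?PA ?EFinB //; exact: mXA.
rewrite -big_seq [RHS]EFinB; congr (_ - _)%E.
have -> : (\prod_(k <- J) (1 - q)%:E)%E = (\prod_(k <- iota 1 K) (1 - q)%:E)%E.
  apply: perm_big; apply: uniq_perm => //; first exact: iota_uniq.
  by move=> k; rewrite JE mem_iota add1n ltnS.
by elim: {+}K 1%N => [|m IH] s /=; rewrite ?big_nil ?expr0 // big_cons IH exprS EFinM.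
Qed.

(** The index takes countably many values; the preimage is split according to them. *)
Lemma measurable_select (d : measure_display) (T : measurableType d) (R : realType)
    (kk : T -> nat) (F : nat -> T -> R) :
  measurable_fun [set: T] kk -> (forall l, (0 < l)%N -> measurable_fun [set: T] (F l)) ->
  (forall w, (0 < kk w)%N) -> measurable_fun [set: T] (fun w => F (kk w) w).
Proof.
move=> mkk mF kk0 _ B mB; rewrite setTI.
have -> : (fun w => F (kk w) w) @^-1` B =
    \bigcup_(l in [set l | (0 < l)%N]) (kk @^-1` [set l] `&` F l @^-1` B).
  apply/seteqP; split=> [w h|w [l _ [/= <-]]//]; exists (kk w) => //; exact: kk0.
apply: bigcup_measurable => l /= l0; apply: measurableI.
  by rewrite -[X in measurable X]setTI; apply: mkk.
by rewrite -[X in measurable X]setTI; exact: mF.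
Qed.

(** By Tonelli, integrating a nonnegative jointly measurable function in [x] is measurable in the
    outcome. Since [f] and [p] are controlled only on [[a, b]], they are extended by 0 to get joint
    measurability on the full product. *)
Lemma measurable_risk (R : realType) (a b : R) (f p s : R -> R) (H : nat)
    (d : measure_display) (T : measurableType d) (X : T -> 'rV[R]_(3 * H).+1) :
  measurable_fun `[a, b] f -> measurable_fun `[a, b] p -> measurable_fun setT s ->
  (forall x, x \in `[a, b] -> 0 <= p x) -> random_vector X ->
  measurable_fun [set: T] (fun w => risk a b f p s (X w)).
Proof.
move=> mf mp ms p0 mX.
have mXi i : measurable_fun [set: T] (fun w => X w 0 i).
  exact: (measurableT_comp (measurable_coord i) mX).
have mab : measurable (`[a, b]%classic : set R) by [].
pose f' : R -> R := f \_ `[a, b]%classic; pose p' : R -> R := p \_ `[a, b]%classic.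
have mf' : measurable_fun setT f' by apply/(measurable_restrict f) => //; rewrite setTI.
have mp' : measurable_fun setT p' by apply/(measurable_restrict p) => //; rewrite setTI.
pose h (z : T * R) : \bar R := ((f' z.2 - realization s (X z.1) z.2) ^+ 2 * p' z.2)%:E.
have mh : measurable_fun setT h.
  apply/measurable_EFinP; apply: measurable_funM; last first.
    by apply: (measurableT_comp mp'); exact: measurable_snd.
  apply: measurable_funX; apply: measurable_funB.
    by apply: (measurableT_comp mf'); exact: measurable_snd.
  have mXf i : measurable_fun setT (fun z : T * R => X z.1 0 i).
    by apply: (measurableT_comp (mXi i)); exact: measurable_fst.
  apply: measurable_funD => //; apply: measurable_sum => j.
  apply: measurable_funM => //; apply: (measurableT_comp ms).
  by apply: measurable_funD => //; apply: measurable_funM => //; exact: measurable_snd.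
have h0 z : (0 <= h z)%E.
  rewrite lee_fin mulr_ge0 ?sqr_ge0 // /p' patchE.
  by case: ifP => // xab; apply: p0; rewrite inE in xab.
have := @measurable_fun_fubini_tonelli_F _ _ _ _ _ (@lebesgue_measure R) h mh h0.
move=> /(measurableT_comp (fine_measurable measurableT)).
apply: eq_measurable_fun => w _ /=; rewrite /risk /Rintegral; congr fine.
rewrite [RHS]integral_mkcond; apply: eq_integral => x _.
rewrite /h /= /f' /p' !patchE; case: ifP => //.
by rewrite mulr0.
Qed.

Lemma measurable_coord_ball (R : realType) (n : nat) (c : 'rV[R]_n) (delta : R) :
  0 < delta ->
  measurable ([set v : 'rV[R]_n | forall k, `|v 0 k - c 0 k| < delta] : set (borel_rV R n)).
Proof.
move=> delta0; apply: sub_sigma_algebra.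
rewrite (_ : [set v | _] = ball c delta); first exact: ball_open.
apply/seteqP; split=> v /=.
  by move=> h; split=> // i j; rewrite ord1 /ball /= distrC.
by move=> [_ h] k; rewrite distrC; exact: h.
Qed.

Lemma limn_einf_near_cst (R : realType) (u : nat -> \bar R) (l : \bar R) (N : nat) :
  (forall n, (N <= n)%N -> u n = l) -> limn_einf u = l.
Proof.
move=> ul; suff /cvg_limn_einf_sup[] : u @ \oo --> l by [].
apply: (@cvg_near_cst _ _ l u \oo); near=> n; apply: ul; near: n.
exact: nbhs_infty_ge.
Unshelve. all: by end_near. Qed.

(** * Success probability of the best of [K] runs *)

Theorem theorem1p1 (R : realType)
  (N : nat) (hN : (0 < N)%N)
  (knot : nat -> R) (a b : R) (hab : a < b)
  (f : R -> R) (hf : {within `[a, b], continuous f})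
  (hknot0 : knot 0%N = a)
  (hknot_lt : forall i : nat, (i < N)%N -> knot i < knot i.+1)
  (hknotN : knot N = b)
  (hf_affine : forall i : nat, (i < N)%N -> affine_on `[knot i, knot i.+1] f)
  (act : nat -> R -> R) (act_infty : R -> R)
  (hact_cont : forall r : nat, (0 < r)%N -> continuous (act r))
  (hact_infty_cont : continuous act_infty)
  (hact_C1 : forall r : nat, (0 < r)%N -> continuously_differentiable (act r))
  (hact_infty : forall x : R, act_infty x = Num.max x 0)
  (hact_bounded : forall x : R,
     (ereal_sup [set ereal_sup [set (`|derive1 (act r) y|)%:E
                                | y in `[(- `|x|)%R, `|x|%R]]
                 | r in [set r : nat | (0 < r)%N]] < +oo)%E)
  (hact_limsup : forall x : R,
     limn_esup (fun r : nat =>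
       (`|act r x - act_infty x|
        + `|derive1 (act r) x - \1_(`]0, +oo[%classic : set R) x|)%:E) = 0%E)
  (p : R -> R)
  (hp_pos : forall x, x \in `[a, b] -> 0 < p x)
  (hp_lip : [lipschitz p x | x in `[a, b]])
  (G : forall H : nat, 'rV[R]_(3 * H).+1 -> 'rV[R]_(3 * H).+1)
  (hG : forall (H : nat) (theta : 'rV[R]_(3 * H).+1), (0 < H)%N ->
     cvgn (fun r : nat => gradient (@risk R a b f p (act r) H) theta) ->
     G H theta =
       limn (fun r : nat => gradient (@risk R a b f p (act r) H) theta))
  (d : measure_display) (Omega : measurableType d) (P : probability Omega R)
  (Theta : forall (H k : nat) (gamma : R) (n : nat),
     Omega -> 'rV[R]_(3 * H).+1)
  (kk : forall (H k : nat) (gamma : R) (n : nat), Omega -> nat)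
  (hTheta_meas : forall (H k : nat) (gamma : R) (n : nat),
     (0 < H)%N -> (0 < k)%N -> random_vector (Theta H k gamma n))
  (hkk_meas : forall (H k : nat) (gamma : R) (n : nat),
     (0 < H)%N -> (0 < k)%N -> measurable_fun [set: Omega] (kk H k gamma n))
  (hTheta0_indep : forall (H : nat) (gamma : R), (0 < H)%N ->
     independent P [set k : nat | (0 < k)%N]
       (fun k => Theta H k gamma 0%N : Omega -> borel_rV R (3 * H).+1))
  (hTheta0_normal : forall (H k : nat) (gamma : R),
     (0 < H)%N -> (0 < k)%N ->
     standard_normal_vector P (Theta H k gamma 0%N))
  (hTheta_step : forall (H k : nat) (gamma : R) (n : nat) (omega : Omega),
     (0 < H)%N -> (0 < k)%N ->
     Theta H k gamma n.+1 omega =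
       Theta H k gamma n omega - gamma *: G H (Theta H k gamma n omega))
  (hkk_argmin : forall (H k : nat) (gamma : R) (n : nat) (omega : Omega),
     (0 < H)%N -> (0 < k)%N ->
     argmin [set l : nat | (1 <= l <= k)%N]
       (fun l => risk a b f p act_infty (Theta H l gamma n omega))
       (kk H k gamma n omega)) :
  exists2 g : R, 0 < g &
    forall gamma : R, 0 < gamma <= g ->
      limn_einf (fun H : nat =>
        limn_einf (fun K : nat =>
          P [set omega |
              limn_esup (fun n : nat =>
                (risk a b f p act_infty
                   (Theta H (kk H K gamma n omega) gamma n omega))%:E)
              = 0%E])) = 1%E.
Proof.
have actE : act_infty = @relu R by apply/funext => x; rewrite hact_infty.
subst act_infty.
have cp := lipschitz_continuous_itv hp_lip.
have mf : measurable_fun `[a, b] f by exact: subspace_continuous_measurable_fun.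
have mp : measurable_fun `[a, b] p by exact: subspace_continuous_measurable_fun.
have [Fb hFb] := continuous_itv_bounded hf.
have [Pb hPb] := continuous_itv_bounded cp.
have p0 x : x \in `[a, b] -> 0 <= p x by move=> /hp_pos/ltW.
have mrelu : measurable_fun setT (@relu R).
  by apply: continuous_measurable_fun; exact: continuous_relu.
have risk_ge0 H (theta : 'rV[R]_(3 * H).+1) : 0 <= risk a b f p (@relu R) theta.
  by apply: Rintegral_ge0 => x xab; rewrite mulr_ge0 ?sqr_ge0 ?p0.
(* The smoothed gradients converge at every parameter vector, so [G] is determined everywhere. *)
have GE H (theta : 'rV[R]_(3 * H).+1) : (0 < H)%N -> G H theta = relu_gradient a b f p theta.
  move=> H0; have c := risk_gradient_cvg hact_C1 hact_bounded hact_limsup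
    mf mp hFb hPb (theta := theta).
  by rewrite hG //; [apply/cvg_lim|apply/cvg_ex; eexists; exact: c].
have [g g0 hg] := gd_risk_cvg hN hab hknot0 hknot_lt hknotN hf_affine hp_pos cp.
exists g => // gamma gammag; have gam0 : 0 < gamma by case/andP: gammag.
(* For each width at least [N] the inner limit is exactly 1, so the outer sequence is eventually
   constant. *)
apply: (@limn_einf_near_cst _ _ _ N) => H NH.
have H0 : (0 < H)%N := leq_trans hN NH.
have [c [delta [delta0 conv]]] := hg gamma gammag H NH.
have [q q0 Pq] := standard_normal_ball c delta0.
pose A : set (borel_rV R (3 * H).+1) :=
  [set v : 'rV[R]_(3 * H).+1 | forall k, `|v 0 k - c 0 k| < delta].
have mA : measurable A by exact: measurable_coord_ball.
pose E K := [set omega | limn_esup (fun n : nat =>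
  (risk a b f p (@relu R) (Theta H (kk H K gamma n omega) gamma n omega))%:E) = 0%E].
have PA k : (0 < k)%N -> P (Theta H k gamma 0%N @^-1` A) = q%:E.
  by move=> k0; apply: Pq; exact: hTheta0_normal.
have q1 : q <= 1.
  rewrite -lee_fin -(PA 1%N) //; apply: probability_le1.
  by rewrite -[X in measurable X]setTI; apply: hTheta_meas.
have hits K := independent_hits K (hTheta0_indep H gamma H0) mA
  (fun k k0 => hTheta_meas H k gamma 0%N H0 k0) PA.
have mE K : (0 < K)%N -> measurable (E K).
  move=> K0.
  have mrisk n : measurable_fun [set: Omega] (fun omega =>
    (risk a b f p (@relu R) (Theta H (kk H K gamma n omega) gamma n omega))%:E).
    apply/measurable_EFinP.
    apply: (@measurable_select _ _ _ (kk H K gamma n) (fun l omega =>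
       risk a b f p (@relu R) (Theta H l gamma n omega))).
    - exact: hkk_meas.
    - by move=> l l0; apply: measurable_risk => //; exact: hTheta_meas.
    - by move=> w; have [/andP[]] := hkk_argmin H K gamma n w H0 K0.
  have := measurable_fun_limn_esup mrisk measurableT (emeasurable_set1 0%E).
  by rewrite setTI.
have sub K : (0 < K)%N ->
    \bigcup_(k in [set k | (1 <= k <= K)%N]) Theta H k gamma 0%N @^-1` A `<=` E K.
  move=> K0 w [k /= kK Ak]; have k0 : (0 < k)%N by case/andP: kK.
  have ck := conv (fun n => Theta H k gamma n w) Ak.
  have {}ck : risk a b f p (@relu R) (Theta H k gamma n w) @[n --> \oo] --> 0.
    by apply: ck => n; rewrite hTheta_step // GE.
  have ckk : risk a b f p (@relu R) (Theta H (kk H K gamma n w) gamma n w) @[n --> \oo] --> 0.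
    (* The selected run may change with [n], but its risk never exceeds that of the good run [k] at
       the same time. *)
    apply: (@squeeze_cvgr _ _ _ _ (cst 0)
      (fun n => risk a b f p (@relu R) (Theta H k gamma n w))) => //.
      apply: nearW => n; rewrite risk_ge0 /=.
      by have [_] := hkk_argmin H K gamma n w H0 K0; apply.
    exact: cvg_cst.
  rewrite /E /=.
  have /cvg_limn_einf_sup[] : (risk a b f p (@relu R)
      (Theta H (kk H K gamma n w) gamma n w))%:E @[n --> \oo] --> 0%:E; last by [].
  by apply: cvg_EFin => //; exact: nearW.
suff /cvg_limn_einf_sup[] : P (E K) @[K --> \oo] --> 1%:E by [].
(* The lower bound is the probability that one of [K] independent starts hits [A]; it tends to 1
   because [0 < q <= 1]. *)
apply: (@squeeze_cvge _ _ _ _ (fun K => (1 - (1 - q) ^+ K)%:E) _ (cst 1%:E)).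
- near=> K; have K0 : (0 < K)%N by near: K; exact: nbhs_infty_gt.
  rewrite probability_le1 ?andbT; last exact: mE.
  rewrite -hits; apply: le_measure; rewrite ?inE; [|exact: mE|exact: sub].
  apply: bigcup_measurable => k /andP[k0 _].
  by rewrite -[X in measurable X]setTI; apply: hTheta_meas.
- apply: cvg_EFin; first exact: nearW.
  rewrite -[X in _ --> X]subr0; apply: cvgB; first exact: cvg_cst.
  by apply: cvg_expr; rewrite ger0_norm ?subr_ge0 // ltrBlDr ltrDl.
- exact: cvg_cst.
Unshelve. all: by end_near. Qed.
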